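(* Let $n\ge3$. The pointwise limit $f^\infty_{R_{n+1}}(x)=\lim_{p\to\infty}f_{R_{p,n+1}}(x)$ exists for all $x\ge0$ and is given as follows. (1) If $n$ is even, with $n_0=\frac n2-1$: $f^\infty_{R_{n+1}}(x)=\mathbf Z_{-i}(x)$ for $i\le x<i+1$, $0\le i\le n_0+1$; $f^\infty_{R_{n+1}}(x)=\mathbf L_{-i}(x)$ for $i\le x<i+1$, $n_0+2\le i\le n-1$; and $0$ for $x\ge n$. (2) If $n$ is odd, with $n_0=\frac{n-1}2$: $f^\infty_{R_{n+1}}(x)=\mathbf Z_{-i}(x)$ for $i\le x<i+1$, $0\le i\le n_0$; $=\mathbf Z_{-n_0-1}(x)$ for $n_0+1\le x<n_0+\frac32$; $=\mathbf L_{-n_0-1}(x)$ for $n_0+\frac32\le x<n_0+2$; $=\mathbf L_{-i}(x)$ for $i\le x<i+1$, $n_0+2\le i\le n-1$; and $0$ for $x\ge n$. Moreover $f^\infty_{R_{n+1}}$ is partially symmetric: $f^\infty_{R_{n+1}}(x)=f^\infty_{R_{n+1}}(n-x)$ for $0\le x\le\frac{n-2}{2}$.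
   Context: For an odd prime $p$ and a perfect field $k$ of characteristic $p$, $R_{p,n+1}=k[x_0,\dots,x_{n+1}]/(x_0^2+\cdots+x_{n+1}^2)$ (standard graded), $\mathbf m=(x_0,\dots,x_{n+1})$, and $f_{R_{p,n+1}}(x)=\lim_{s\to\infty}q^{-n}\dim_k(R_{p,n+1}/\mathbf m^{[q]})_{\lfloor xq\rfloor}$, $q=p^s$, $\mathbf m^{[q]}=(x_0^q,\dots,x_{n+1}^q)$, is the HK density function. Let $Y_k=\binom{k+n+1}{n+1}-\binom{k+n-1}{n+1}$ ($k\ge0$). Define polynomials in $x$: $\mathbf Z_0(x)=\frac{2x^n}{n!}$, $\mathbf Z_{-i}(x)=\frac{2x^n}{n!}-\sum_{k=1}^{i}Y_k\mathbf Z_{-(i-k)}(x-k)$ for $1\le i\le n-1$; $\mathbf L_{-(n-1)}(x)=\frac{2(n-x)^n}{n!}$, $\mathbf L_{-i}(x)=\frac{2(n-x)^n}{n!}-\sum_{k=1}^{n-1-i}Y_k\mathbf L_{-(i+k)}(x+k)$ for $0\le i\le n-2$. *)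

(* Defs.v *)
From HB Require Import structures.
From mathcomp Require Import all_boot all_order all_algebra.
From mathcomp Require Import mpoly.
From mathcomp Require Import all_classical all_reals all_analysis.
Set Implicit Arguments. Unset Strict Implicit. Unset Printing Implicit Defensive.
Import Order.TTheory GRing.Theory Num.Theory numFieldNormedType.Exports.
Local Open Scope ring_scope.

(* monomials with total degree < d.+1, i.e. <= d *)
Notation monos N d := (mpoly.bmultinom N d.+1).

Definition xvar (k : fieldType) (N : nat) (i : 'I_N) : mpoly.mpoly N k :=
  mpoly.mpolyX k (mpoly.mnm1 i).

Definition quadric (k : fieldType) (N : nat) : mpoly.mpoly N k :=
  \sum_(i < N) xvar k i ^+ 2.

Definition gen (k : fieldType) (N q : nat) (j : option 'I_N) : mpoly.mpoly N k :=
  match j with None => quadric k N | Some i => xvar k i ^+ q end.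
Definition gen_deg (q : nat) (N : nat) (j : option 'I_N) : nat :=
  match j with None => 2%N | Some _ => q end.

(* Coefficient matrix of the spanning family { m * g_j : m monomial,
   deg m + deg g_j = d } of the degree-d part of the ideal
   J = (Q, x_0^q, ..., x_{n+1}^q), with columns indexed by the monomials of
   degree <= d (those of degree < d give zero columns). *)
Definition ideal_mx (k : fieldType) (N q d : nat) :
  'M[k]_(#|{: option 'I_N * monos N d}|, #|{: monos N d}|) :=
  \matrix_(r, c)
    let: (j, m) := (enum_val r : option 'I_N * monos N d) in
    let: mc := (enum_val c : monos N d) in
    if (mpoly.mdeg m + gen_deg q j == d)%N then
      mpoly.mcoeff (mc : mpoly.multinom N)
        (mpoly.mpolyX k (m : mpoly.multinom N) * gen k q j)
    else 0.

(* dim_k (S/J)_d = #(monomials of degree d) - dim_k J_d *)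
Definition hilb (k : fieldType) (N q d : nat) : nat :=
  (#|[set m : monos N d | mpoly.mdeg (m : mpoly.multinom N) == d]|
   - \rank (ideal_mx k N q d))%N.

(* dim_k (R_{p,n+1} / m^[q])_d, R_{p,n+1} = k[x_0..x_{n+1}]/(sum x_i^2) *)
Definition hilbR (k : fieldType) (n q d : nat) : nat := hilb k n.+2 q d.

(* HK density function f_{R_{p,n+1}}(x) = lim_s q^{-n} dim (R/m^[q])_{floor(xq)},
   q = p^s  (the limit exists by Trivedi's theorem; we use the library's lim). *)
Definition hk_density (R : realType) (k : fieldType) (p n : nat) (x : R) : R :=
  limn (fun s : nat =>
         (((p ^ s)%:R ^- n) *
         (hilbR k n (p ^ s) `|Num.floor (x * (p ^ s)%:R)|%N)%:R : R)).

Definition perfect_char (k : fieldType) (p : nat) : Prop :=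
  p \in [pchar k] /\ forall y : k, exists z : k, z ^+ p = y.

Definition Ycoef (R : realType) (n k : nat) : R :=
  'C(k + n + 1, n + 1)%:R - 'C(k + n - 1, n + 1)%:R.

Fixpoint Glist (R : realType) (n : nat) (b : R -> R) (s : R) (j : nat)
  : seq (R -> R) :=
  match j with
  | 0 => [:: b]
  | j'.+1 =>
      let l := Glist n b s j' in
      rcons l (fun x => b x - \sum_(1 <= k < j'.+2)
                 Ycoef R n k * (nth (fun _ => 0) l (j'.+1 - k)%N) (x + s * k%:R))
  end.
Definition Gfun (R : realType) (n : nat) (b : R -> R) (s : R) (j : nat) : R -> R :=
  nth (fun _ => 0) (Glist n b s j) j.

Definition Zpoly (R : realType) (n i : nat) : R -> R :=
  Gfun n (fun x => 2 * x ^+ n / (n`!)%:R) (-1) i.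
(* Lpoly n i = L_{-i}  (0 <= i <= n-1), via M_j = L_{-(n-1-j)} *)
Definition Lpoly (R : realType) (n i : nat) : R -> R :=
  Gfun n (fun x => 2 * (n%:R - x) ^+ n / (n`!)%:R) 1 (n.-1 - i)%N.

Definition finf (R : realType) (n : nat) (x : R) : R :=
  if n%:R <= x then 0 else
  let i := `|Num.floor x|%N in
  if ~~ odd n then
    let n0 := (n./2 - 1)%N in
    if (i <= n0.+1)%N then Zpoly n i x else Lpoly n i x
  else
    let n0 := n./2 in
    if (i <= n0)%N then Zpoly n i x
    else if i == n0.+1 then
      (if x < n0.+1%:R + 1/2 then Zpoly n n0.+1 x else Lpoly n n0.+1 x)
    else Lpoly n i x.

(* Main.v *)
(** The degree-[D] part of [k[x_1..x_N]/(Q, x_i^q)], [Q] the sum of squares, is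
   dual to the kernel of the operator dual to [Q] on functions on the box
   [[0, q)^N] (Macaulay's inverse system), so that everything reduces to
   dimensions of kernels of powers of such operators.

   For [q = p], the complete intersection [k[x_1..x_N]/(x_i^p)] is, as a module
   over [k[Q]/(Q^p)], a sum of strings that either have length [p] or are centred
   at the middle degree: such modules are stable under adjoining a variable by
   the Clebsch-Gordan rule for [k[t]/(t^2) (x) k[t]/(t^m)], valid when [m] is
   invertible. In low degrees this gives the Hilbert series
   [(1 - t^2) / (1 - t^(2p)) * ((1 - t^p) / (1 - t))^N], which satisfies the same
   recursion as the [Z_(-i)]; the high degrees follow by reflection.

   The freeness of [k[x]] over [k[x^p]], together with Lipschitz bounds for the
   Hilbert function, shows that passing from [p^s] to [p^(s+1)] changes the
   normalised Hilbert function by [O(p^(-s))] with a constant independent of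
   [p]. Hence the density is within [O(1/p)] of its first approximation. *)

Require Import Defs.
From HB Require Import structures.
From mathcomp Require Import all_boot all_order all_algebra.
From mathcomp Require Import mpoly.
From mathcomp Require Import all_classical all_reals all_analysis.
From mathcomp Require Import ssrAC zify ring lra.
Import Order.TTheory GRing.Theory Num.Theory numFieldNormedType.Exports.
Set Implicit Arguments. Unset Strict Implicit. Unset Printing Implicit Defensive.
Local Open Scope ring_scope.

(** * Dimensions of subspaces *)

(** In the dual, truncation at [q] is extension by zero and multiplication by a variable is a shift,
    so kernels are handled more directly than quotients. On [k[x]/(x^q)] the kernel of [T + x^2]
    splits by parity of the exponent into kernels of [T^(uphalf q)] and [T^(q./2)]: the Hilbert
    function in [n + 2] variables becomes a question about powers in [n + 1] variables, and the
    exponents grow with [q]. This shapes the Frobenius step, which sees only exponents divisible by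
    [p]: for odd [p] and [q], [uphalf (p * q)] misses [p * uphalf q] by [p./2], and correcting this
    costs [O(p^n q^(n-1))], the same order as the Lipschitz error.

    The break at [x = (n + 2) / 2] comes from the middle degree [(n + 2)(p - 1) / 2] of the box.
    Sufficiently far above it only strings of length [p] meet the kernel of the operator; their
    positions are symmetric, whence the reflection [d -> n p - n - d] and, after scaling,
    [x -> n - x]. So one function [G], glued from the [Z_(-i)], describes both parities of [n]: the
    limit is [G(x)] below [(n + 2) / 2] and [G(n - x)] from there on. *)

Section Dimension.
Variable k : fieldType.
Implicit Types V W : vectType k.

Lemma linear_lfunE V W (f : V -> W) : linear f -> linfun f =1 f.
Proof.
move=> lf; pose F : {linear V -> W} := HB.pack f (GRing.isLinear.Build k V W *:%R f lf).
exact: (lfunE F).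
Qed.

Lemma lin0 V W (f : V -> W) : linear f -> f 0 = 0.
Proof. by move=> lf; rewrite -(linear_lfunE lf) linear0. Qed.

Lemma linB V W (f : V -> W) u v : linear f -> f (u - v) = f u - f v.
Proof. by move=> lf; rewrite -!(linear_lfunE lf) linearB. Qed.

Lemma linZ V W (f : V -> W) a u : linear f -> f (a *: u) = a *: f u.
Proof. by move=> lf; rewrite -!(linear_lfunE lf) linearZ. Qed.

Lemma linD V W (f : V -> W) u v : linear f -> f (u + v) = f u + f v.
Proof. by move=> lf; rewrite -!(linear_lfunE lf) linearD. Qed.

Lemma lin_sum V W (f : V -> W) (I : Type) (r : seq I) (P : pred I) (F : I -> V) :
  linear f -> f (\sum_(i <- r | P i) F i) = \sum_(i <- r | P i) f (F i).
Proof.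
by move=> lf; rewrite -(linear_lfunE lf) linear_sum; apply: eq_bigr => i _; exact: linear_lfunE.
Qed.

Definition kerv V W (f : V -> W) (U : {vspace V}) : {vspace V} := (U :&: lker (linfun f))%VS.

Lemma mem_kerv V W (f : V -> W) U u : linear f ->
  (u \in kerv f U) = (u \in U) && (f u == 0).
Proof. by move=> lf; rewrite memv_cap memv_ker linear_lfunE. Qed.

Lemma dim_kerv_le V W (f : V -> W) (U : {vspace V}) (U1 : {vspace W}) :
  linear f -> (forall u, u \in U -> f u \in U1) ->
  (\dim U <= \dim (kerv f U) + \dim U1)%N.
Proof.
move=> lf fU; rewrite -(limg_ker_dim (linfun f) U) leq_add2l dimvS //.
by apply/subvP => w /memv_imgP[u uU ->]; rewrite linear_lfunE // fU.
Qed.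

Lemma dim_kerv_eq V W (f : V -> W) (U : {vspace V}) (U1 : {vspace W}) :
  linear f -> (forall u, u \in U -> f u \in U1) ->
  (forall w, w \in U1 -> exists2 u, u \in U & f u = w) ->
  \dim U = (\dim (kerv f U) + \dim U1)%N.
Proof.
move=> lf fU sf; rewrite -(limg_ker_dim (linfun f) U); congr (_ + \dim _)%N.
apply/eqP; rewrite eqEsubv; apply/andP; split; apply/subvP => w.
  by move=> /memv_imgP[u uU ->]; rewrite linear_lfunE // fU.
by move=> /sf[u uU <-]; rewrite -linear_lfunE // memv_img.
Qed.

Lemma dim_inj_le V W (f : V -> W) (U : {vspace V}) (U1 : {vspace W}) :
  linear f -> (forall u, u \in U -> f u \in U1) ->
  (forall u, u \in U -> f u = 0 -> u = 0) -> (\dim U <= \dim U1)%N.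
Proof.
move=> lf fU inj; have := dim_kerv_le lf fU.
suff -> : kerv f U = 0%VS by rewrite dimv0.
apply/eqP; rewrite -subv0; apply/subvP => u; rewrite mem_kerv // => /andP[uU /eqP /inj ->] //.
exact: mem0v.
Qed.

Lemma dim_bij V W (f : V -> W) (U : {vspace V}) (U1 : {vspace W}) :
  linear f -> (forall u, u \in U -> f u \in U1) ->
  (forall u, u \in U -> f u = 0 -> u = 0) ->
  (forall w, w \in U1 -> exists2 u, u \in U & f u = w) ->
  \dim U = \dim U1.
Proof.
move=> lf fU inj sf; rewrite (dim_kerv_eq lf fU sf).
suff -> : kerv f U = 0%VS by rewrite dimv0.
apply/eqP; rewrite -subv0; apply/subvP => u; rewrite mem_kerv // => /andP[uU /eqP /inj ->] //.
exact: mem0v.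
Qed.

Lemma dim_split V W1 W2 (f : V -> W1) (g : V -> W2) (U : {vspace V})
    (U1 : {vspace W1}) (U2 : {vspace W2}) :
  linear f -> linear g ->
  (forall u, u \in U -> f u \in U1) -> (forall u, u \in U -> g u \in U2) ->
  (forall u, u \in U -> f u = 0 -> g u = 0 -> u = 0) ->
  (forall a b, a \in U1 -> b \in U2 -> exists2 u, u \in U & f u = a /\ g u = b) ->
  \dim U = (\dim U1 + \dim U2)%N.
Proof.
move=> lf lg fU gU inj sur.
have sf w : w \in U1 -> exists2 u, u \in U & f u = w.
  by move=> wU; have [u uU [<- _]] := sur w 0 wU (mem0v _); exists u.
rewrite (dim_kerv_eq lf fU sf) addnC; congr addn.
apply: (dim_bij lg) => [u|u|w wU].
- by rewrite mem_kerv // => /andP[/gU].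
- by rewrite mem_kerv // => /andP[uU /eqP]; apply: inj.
- have [u uU [fu gu]] := sur 0 w (mem0v _) wU.
  by exists u => //; rewrite mem_kerv // uU fu /=.
Qed.

Lemma dim_cV n : \dim (@fullv k 'cV[k]_n) = n.
Proof. by rewrite dimvf dim_matrix; exact: muln1. Qed.

Lemma dim_solutions m n (A : 'M[k]_(m, n)) :
  \dim (kerv (fun u : 'cV[k]_n => A *m u) fullv) = (n - \rank A)%N.
Proof.
have lA m' n' (B : 'M[k]_(m', n')) : linear (fun u : 'cV[k]_n' => B *m u).
  by move=> a u v; rewrite mulmxDr scalemxAr.
have rkA : \dim (linfun (fun u : 'cV[k]_n => A *m u) @: fullv)%VS = \rank A.
  rewrite -[RHS]dim_cV; apply/esym/(dim_bij (lA _ _ (col_base A))) => [u _|u _ Cu0|w].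
  + apply/memv_imgP; have [R RK] := row_freeP (row_base_free A).
    exists (R *m u); first exact: memvf.
    rewrite linear_lfunE; last exact: lA.
    transitivity (col_base A *m row_base A *m (R *m u)); last by rewrite mulmx_base.
    by rewrite -mulmxA (mulmxA _ R) RK mul1mx.
  + have [L LK] := row_fullP (col_base_full A).
    by rewrite -[u]mul1mx -LK -mulmxA Cu0 mulmx0.
  + move=> /memv_imgP[u _ ->]; exists (row_base A *m u); first exact: memvf.
    by rewrite linear_lfunE; [rewrite mulmxA mulmx_base|exact: lA].
apply: (@addIn (\rank A)); rewrite subnK ?rank_leq_col // -rkA -[RHS]dim_cV.
apply/esym/dim_kerv_eq => [|u _|w]; first exact: lA.
- by apply/memv_imgP; exists u; rewrite ?memvf // linear_lfunE //; exact: lA.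
- by move=> /memv_imgP[u _ ->]; exists u; rewrite ?memvf // linear_lfunE //; exact: lA.
Qed.

Definition pwv (I : finType) V (U : I -> {vspace V}) : {vspace {ffun I -> V}} :=
  (\bigcap_i (linfun (fun u : {ffun I -> V} => u i) @^-1: U i))%VS.

Lemma ffun_eval_linear (I : finType) V (i : I) : linear (fun u : {ffun I -> V} => u i).
Proof. by move=> a u v; rewrite !ffunE. Qed.

Lemma mem_pwv (I : finType) V (U : I -> {vspace V}) u :
  (u \in pwv U) = [forall i, u i \in U i].
Proof.
rewrite memvE; apply/subv_bigcapP/forallP => [H i|H i _].
  by have := H i isT; rewrite -memvE -memv_preim linear_lfunE //; exact: ffun_eval_linear.
by rewrite -memvE -memv_preim linear_lfunE //; exact: ffun_eval_linear.
Qed.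

Lemma dim_pwv (I : finType) V (U : I -> {vspace V}) : \dim (pwv U) = (\sum_i \dim (U i))%N.
Proof.
pose single i (w : V) : {ffun I -> V} := [ffun j => if j == i then w else 0].
suff H (r : seq I) : uniq r ->
    \dim (pwv (fun i => if i \in r then U i else 0%VS)) = (\sum_(i <- r) \dim (U i))%N.
  rewrite -(H (index_enum I)) ?index_enum_uniq //; congr (\dim _).
  apply/vspaceP => u; rewrite !mem_pwv; apply: eq_forallb => i.
  by rewrite mem_index_enum.
elim: r => [|i r IH] /=.
  move=> _; rewrite big_nil; apply/eqP; rewrite dimv_eq0 -subv0; apply/subvP => u.
  rewrite mem_pwv => /forallP Hu; rewrite memv0; apply/eqP/ffunP => j.
  by have := Hu j; rewrite ?in_nil memv0 ffunE => /eqP.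
move=> /andP[ir ur]; rewrite big_cons -IH //.
pose g (u : {ffun I -> V}) : {ffun I -> V} := [ffun j => if j == i then 0 else u j].
apply: (@dim_split _ _ _ (fun u : {ffun I -> V} => u i) g).
- exact: ffun_eval_linear.
- by move=> a u v; apply/ffunP => j; rewrite !ffunE; case: eqP => _; rewrite ?scaler0 ?addr0.
- by move=> u; rewrite mem_pwv => /forallP/(_ i); rewrite in_cons eqxx.
- move=> u; rewrite !mem_pwv => /forallP Hu; apply/forallP => j; rewrite ffunE.
  have := Hu j; rewrite in_cons; case: eqP => [->|_] //= _; exact: mem0v.
- move=> u _ ui gu; apply/ffunP => j; rewrite [RHS]ffunE.
  by have /ffunP/(_ j) := gu; rewrite !ffunE; case: eqP => [->|].
- move=> a b aU; rewrite mem_pwv => /forallP bU.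
  exists [ffun j => if j == i then a else b j].
    rewrite mem_pwv; apply/forallP => j; rewrite ffunE in_cons.
    by case: eqP => [->|_] //=; apply: bU.
  split; first by rewrite ffunE eqxx.
  apply/ffunP => j; rewrite !ffunE; case: eqP => // ->.
  by have := bU i; rewrite (negPf ir) memv0 => /eqP.
Qed.

End Dimension.

(** * Graded spaces with an operator of degree -2 *)

(** Degrees are integers, so that [d - 2] and the reflections [c - d] are never truncated. *)
Record gmod (k : fieldType) := GMod {
  gsp :> vectType k;
  gop : gsp -> gsp;
  ggr : int -> {vspace gsp};
  gop_linear : linear gop;
  gop_gr : forall d u, u \in ggr d -> gop u \in ggr (d - 2) }.
Arguments gop {k} g _ : simpl never.
Arguments ggr {k} g _ : simpl never.

Section GMod.
Variable k : fieldType.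
Implicit Types V W : gmod k.

Lemma iter_linear (V : vectType k) (f : V -> V) r : linear f -> linear (iter r f).
Proof. by move=> lf; elim: r => [|r IH] a u v //=; rewrite IH lf. Qed.

Lemma iterg_linear V r : linear (iter r (gop V)).
Proof. by apply: iter_linear; apply: gop_linear. Qed.

Lemma iterg_gr V r d u : u \in ggr V d -> iter r (gop V) u \in ggr V (d - r%:Z * 2).
Proof.
elim: r => [|r IH] /= ud; first by rewrite mul0r subr0.
by have /gop_gr := IH ud; congr (_ \in ggr V _); lia.
Qed.

Definition gker r V d : {vspace V} := kerv (iter r (gop V)) (ggr V d).
Definition nd V d : nat := \dim (ggr V d).
(* In degree [d], the dimension of the cokernel of the [r]-th power of the
   operator dual to [gop V]. *)
Definition cok r V d : nat := \dim (gker r V d).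

Lemma mem_gker r V d u : (u \in gker r V d) = (u \in ggr V d) && (iter r (gop V) u == 0).
Proof. by rewrite mem_kerv //; apply: iterg_linear. Qed.

Lemma gkerI r V d u : u \in ggr V d -> iter r (gop V) u = 0 -> u \in gker r V d.
Proof. by rewrite mem_gker => -> /eqP. Qed.

Lemma cok_le_nd r V d : (cok r V d <= nd V d)%N.
Proof. by apply: dimvS; apply: capvSl. Qed.

Lemma cok0 V d : cok 0 V d = 0%N.
Proof.
apply/eqP; rewrite dimv_eq0 -subv0; apply/subvP => u.
by rewrite mem_gker memv0 => /andP[].
Qed.

Lemma cok_mono r V d : (cok r V d <= cok r.+1 V d)%N.
Proof.
apply/dimvS/subvP => u; rewrite !mem_gker => /andP[-> /eqP /= ->].
by rewrite (lin0 (@gop_linear _ V)) eqxx.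
Qed.

Lemma cok_succ_le r V d : (cok r.+1 V d <= cok r V d + cok 1 V (d - r%:Z * 2))%N.
Proof.
have l := @iterg_linear V r.
apply: leq_trans (dim_kerv_le (U1 := gker 1 V (d - r%:Z * 2)) l _) _.
  by move=> u; rewrite !mem_gker => /andP[ud /= ->]; rewrite iterg_gr.
rewrite leq_add2r; apply/dimvS/subvP => u; rewrite mem_kerv // !mem_gker.
by case/andP => /andP[-> _] ->.
Qed.

Lemma gmod_iso V W (f : V -> W) :
  linear f -> (forall u, f u = 0 -> u = 0) -> (forall w, exists u, f u = w) ->
  (forall u, f (gop V u) = gop W (f u)) ->
  (forall d u, (f u \in ggr W d) = (u \in ggr V d)) ->
  forall r d, cok r V d = cok r W d.
Proof.
move=> lf inj sur fT fg r d.
have fTr s u : f (iter s (gop V) u) = iter s (gop W) (f u).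
  by elim: s => //= s <-.
apply: (dim_bij lf) => [u|u _|w].
- by rewrite !mem_gker fg => /andP[-> /eqP E]; rewrite -fTr E lin0 // eqxx.
- exact: inj.
- have [u <-] := sur w; rewrite mem_gker fg => /andP[ud /eqP E].
  exists u => //; rewrite mem_gker ud /=; apply/eqP/inj.
  by rewrite fTr.
Qed.

Section Ev.
Variables (q : nat) (V : vectType k).
Implicit Types u v : {ffun 'I_q -> V}.

(** The value [0] beyond [q] encodes the truncation: a shift past the end of the box vanishes with
    no case distinction. *)
Definition ev u (j : nat) : V := if insub j is Some i then u i else 0.
Definition mk (f : nat -> V) : {ffun 'I_q -> V} := [ffun i : 'I_q => f i].

Lemma ev_ord u (i : 'I_q) : ev u i = u i.
Proof. by rewrite /ev valK. Qed.

Lemma ev_ge u j : (q <= j)%N -> ev u j = 0.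
Proof. by move=> qj; rewrite /ev insubF // ltnNge qj. Qed.

Lemma ev_mk f j : ev (mk f) j = if (j < q)%N then f j else 0.
Proof.
case: ltnP => [jq|]; last exact: ev_ge.
by rewrite (ev_ord _ (Ordinal jq)) ffunE.
Qed.

Lemma ev_ext u v : (forall j, (j < q)%N -> ev u j = ev v j) -> u = v.
Proof. by move=> H; apply/ffunP => i; rewrite -!ev_ord H. Qed.

Lemma ev0 j : ev 0 j = 0.
Proof. by rewrite /ev; case: insub => // i; rewrite ffunE. Qed.

Lemma ev_linear j : linear (ev^~ j).
Proof. by move=> a u v; rewrite /ev; case: insub => [i|]; rewrite ?ffunE // scaler0 addr0. Qed.

Lemma mk_linear (W : vectType k) (F : W -> nat -> V) :
  (forall j, linear (F^~ j)) -> linear (fun w => mk (F w)).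
Proof. by move=> lF a u v; apply/ffunP => i; rewrite !ffunE lF. Qed.

End Ev.

(** * Adjoining one truncated variable *)

Section Ext.
Variables (e s q : nat) (es : (e * s = 2)%N) (V : gmod k).
Implicit Types u : {ffun 'I_q -> V}.

(** Dual of [T + y^s] on [V[y]/(y^q)], where [y] has degree [e]; since [e * s = 2] the sum is
    homogeneous. Treating [t] and [x^2] by one construction lets variables of both kinds be
    exchanged by a single lemma. *)
Definition exop u : {ffun 'I_q -> V} := mk q (fun j => ev u (j + s) + gop V (ev u j)).
Definition exgr d := pwv (fun i : 'I_q => ggr V (d - (e * i)%:Z)).

Lemma ev_exop u j : ev (exop u) j = ev u (j + s) + gop V (ev u j).
Proof.
rewrite ev_mk; case: ltnP => // qj; rewrite !ev_ge ?(lin0 (@gop_linear _ V)) ?addr0 //.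
by rewrite (leq_trans qj) // leq_addr.
Qed.

Lemma mem_exgr d u :
  reflect (forall j, ev u j \in ggr V (d - (e * j)%:Z)) (u \in exgr d).
Proof.
rewrite mem_pwv; apply: (iffP forallP) => H i; last by rewrite -ev_ord.
case: (ltnP i q) => [iq|]; last by move/ev_ge ->; exact: mem0v.
by rewrite (ev_ord u (Ordinal iq)); apply: H.
Qed.

Lemma exop_linear : linear exop.
Proof.
apply: mk_linear => j a u v; rewrite (ev_linear _ a) (ev_linear j a) gop_linear scalerDr.
by rewrite addrACA.
Qed.

Lemma exop_gr d u : u \in exgr d -> exop u \in exgr (d - 2).
Proof.
move=> /mem_exgr ud; apply/mem_exgr => j; rewrite ev_exop memvD //.
  by have := ud (j + s)%N; congr (_ \in ggr V _); lia.
by have /gop_gr := ud j; congr (_ \in ggr V _); lia.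
Qed.

Definition ext := @GMod k {ffun 'I_q -> V} exop exgr exop_linear exop_gr.

Lemma nd_ext d : nd ext d = (\sum_(i < q) nd V (d - (e * i)%:Z))%N.
Proof. exact: dim_pwv. Qed.

Lemma ev_iter_ext r (u : ext) j : ev (iter r (gop ext) u) j =
  \sum_(i < r.+1) iter (r - i) (gop V) (ev u (j + s * i)) *+ 'C(r, i).
Proof.
elim: r j => [|r IH] j; first by rewrite big_ord1 muln0 addn0.
rewrite [LHS]ev_exop !IH (lin_sum _ _ _ (@gop_linear _ V)).
rewrite big_ord_recr [X in _ + X = _]big_ord_recl [RHS]big_ord_recl /=.
rewrite [X in _ = _ + X]big_ord_recr /= !subnn !bin0 !subn0 !mulr1n.
rewrite [LHS](AC (2*2) (3*((1*4)*2))) /=; congr (_ + _).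
congr (_ + _); last first.
  by rewrite /bump leq0n add1n ?subnn !binn mulnS addnA.
rewrite -big_split /=; apply: eq_bigr => i _; rewrite /bump !add1n subSS.
rewrite binS mulrnDr addrC; congr (_ + _); last by rewrite mulnS addnA.
have iltr := ltn_ord i; rewrite -(subnSK iltr) /=.
by rewrite -!(scaler_nat 'C(_, _)) (linZ _ _ (@gop_linear _ V)).
Qed.

End Ext.

End GMod.
Arguments ext {k} e s q es V.
Arguments gker {k} r V d.
Arguments nd {k} V d.
Arguments cok {k} r V d.

(* Duals of [V[t]/(t^m)] and of [V[x]/(x^q)], with [T + t] and [T + x^2] acting;
   [t] has degree 2 and [x] degree 1. *)
Definition dl k m (V : gmod k) : gmod k := ext 2 1 m erefl V.
Definition vx k q (V : gmod k) : gmod k := ext 1 2 q erefl V.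

Section ExtTheory.
Variable k : fieldType.
Implicit Types V W : gmod k.

Lemma gop0 V : gop V 0 = 0. Proof. exact/lin0/gop_linear. Qed.
Lemma gopD V u v : gop V (u + v) = gop V u + gop V v. Proof. exact/linD/gop_linear. Qed.
Lemma gopZ V a u : gop V (a *: u) = a *: gop V u. Proof. exact/linZ/gop_linear. Qed.
Lemma evD q (V : vectType k) (u v : {ffun 'I_q -> V}) j : ev (u + v) j = ev u j + ev v j.
Proof. exact: (linD _ _ (ev_linear j)). Qed.

Lemma ev_gop e s q es V (u : ext e s q es V) j :
  ev (gop (ext e s q es V) u) j = ev u (j + s) + gop V (ev u j).
Proof. exact: ev_exop. Qed.

Lemma mem_ggr e s q es V d (u : ext e s q es V) :
  reflect (forall j, ev u j \in ggr V (d - (e * j)%:Z)) (u \in ggr (ext e s q es V) d).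
Proof. exact: mem_exgr. Qed.

Definition swapx q q' (V : vectType k) (u : {ffun 'I_q -> {ffun 'I_q' -> V}}) :
    {ffun 'I_q' -> {ffun 'I_q -> V}} :=
  mk q' (fun j => mk q (fun i => ev (ev u i) j)).

Lemma ev_swapx q q' (V : vectType k) (u : {ffun 'I_q -> {ffun 'I_q' -> V}}) i j :
  ev (ev (swapx u) j) i = ev (ev u i) j.
Proof.
rewrite ev_mk; case: ltnP => [_|jq]; last by rewrite ev0 ev_ge.
by rewrite ev_mk; case: ltnP => // iq; rewrite (ev_ge _ iq) ev0.
Qed.

Lemma ev2_ext q q' (V : vectType k) (u v : {ffun 'I_q -> {ffun 'I_q' -> V}}) :
  (forall i j, ev (ev u i) j = ev (ev v i) j) -> u = v.
Proof. by move=> H; apply: ev_ext => i _; apply: ev_ext => j _. Qed.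

Lemma swapxK q q' (V : vectType k) : cancel (@swapx q q' V) (@swapx q' q V).
Proof. by move=> u; apply: ev2_ext => i j; rewrite !ev_swapx. Qed.

Lemma swapx_linear q q' (V : vectType k) : linear (@swapx q q' V).
Proof.
by move=> a u v; apply: ev2_ext => i j; rewrite ev_swapx !(ev_linear _ a) !ev_swapx.
Qed.

Lemma cok_swap r e s q es e' s' q' es' V d :
  cok r (ext e s q es (ext e' s' q' es' V)) d = cok r (ext e' s' q' es' (ext e s q es V)) d.
Proof.
apply: (@gmod_iso _ (ext e s q es (ext e' s' q' es' V)) (ext e' s' q' es' (ext e s q es V))
  (@swapx q q' V)) => [|u u0|w|u|{}d u].
- exact: swapx_linear.
- by rewrite -[u]swapxK u0; apply: lin0; apply: swapx_linear.
- by exists (swapx w); rewrite swapxK.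
- apply: ev2_ext => j i; rewrite ev_swapx.
  rewrite (ev_gop (V := ext e' s' q' es' V) u) (ev_gop (V := ext e s q es V) (swapx u)).
  by rewrite !evD !ev_gop !ev_swapx addrCA.
- apply/mem_ggr/mem_ggr => H i; apply/mem_ggr => j.
    have /mem_ggr /(_ i) := H j; rewrite ev_swapx.
    by congr (_ \in ggr V _); lia.
  have /mem_ggr /(_ i) := H j; rewrite ev_swapx.
  by congr (_ \in ggr V _); lia.
Qed.

Lemma gker1_dl m V d (u : dl m V) : u \in gker 1 (dl m V) d ->
  forall j, ev u j = (-1) ^+ j *: iter j (gop V) (ev u 0).
Proof.
rewrite mem_gker => /andP[_ /eqP /= Tu]; elim=> [|j IH]; first by rewrite scale1r.
have := ev_gop u j; rewrite Tu ev0 addn1 => /esym/eqP; rewrite addr_eq0 => /eqP ->.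
by rewrite IH gopZ exprS -scalerA scaleN1r.
Qed.

(** A kernel element is determined by its value at [0], its value at [j] being [(-T)^j] applied to
    it; that the value at [m] is zero gives the condition [T^m = 0]. *)
Lemma cok1_dl m V d : cok 1 (dl m V) d = cok m V d.
Proof.
apply: (@dim_bij _ (dl m V) V (fun u : dl m V => ev u 0)) => [|u uK|u uK u0|w].
- exact: ev_linear.
- have um := gker1_dl uK m; rewrite mem_gker.
  move: uK; rewrite mem_gker => /andP[/mem_ggr /(_ 0%N)]; rewrite muln0 subr0 => -> _ /=.
  rewrite ev_ge // in um; have := congr1 (fun x => (-1) ^+ m *: x) um.
  by rewrite scaler0 scalerA -expr2 -exprM mulnC exprM sqrrN expr1n expr1n scale1r => <-.
- apply: ev_ext => j _; rewrite (gker1_dl uK) u0 ev0.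
  by rewrite (lin0 (@iterg_linear _ V j)) scaler0.
- rewrite mem_gker => /andP[wd /eqP wm].
  pose u : dl m V := mk m (fun j => (-1) ^+ j *: iter j (gop V) w).
  have uE j : ev u j = (-1) ^+ j *: iter j (gop V) w.
    rewrite ev_mk; case: ltnP => // mj; rewrite -(subnK mj) iterD wm.
    by rewrite (lin0 (@iterg_linear _ V _)) scaler0.
  exists u; last by rewrite uE scale1r.
  rewrite mem_gker; apply/andP; split.
    apply/mem_ggr => j; rewrite uE memvZ //.
    by have := iterg_gr j wd; congr (_ \in ggr V _); lia.
  apply/eqP/ev_ext => j _; rewrite /= ev_gop !uE ev0 gopZ addn1 exprS -scalerA scaleN1r /=.
  by rewrite addNr.
Qed.

(* Both sides compute the cokernel of [T + a + b] on [V[a, b]/(a^r, b^m)]. *)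
Lemma cok_dl_sym r m V d : cok r (dl m V) d = cok m (dl r V) d.
Proof. by rewrite -cok1_dl cok_swap cok1_dl. Qed.

(** With [t = x^2], [k[x]/(x^q)] is [k[t]/(t^(uphalf q))] plus [x] times [k[t]/(t^(q./2))], and the
    operator respects this splitting; the factor [x] accounts for the shift of degree. *)
Lemma cok_vx r q V d :
  cok r (vx q V) d = (cok r (dl (uphalf q) V) d + cok r (dl q./2 V) (d - 1))%N.
Proof.
pose f (u : vx q V) : dl (uphalf q) V := mk _ (fun j => ev u (j.*2)).
pose g (u : vx q V) : dl q./2 V := mk _ (fun j => ev u (j.*2.+1)).
have fE u j : ev (f u) j = ev u (j.*2).
  by rewrite ev_mk; case: ltnP => // qj; rewrite ev_ge //; lia.
have gE u j : ev (g u) j = ev u (j.*2.+1).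
  by rewrite ev_mk; case: ltnP => // qj; rewrite ev_ge //; lia.
have fT s u : f (iter s (gop (vx q V)) u) = iter s (gop (dl _ V)) (f u).
  elim: s => //= s <-; apply: ev_ext => j _; rewrite fE !ev_gop !fE.
  by congr (ev _ _ + _); lia.
have gT s u : g (iter s (gop (vx q V)) u) = iter s (gop (dl _ V)) (g u).
  elim: s => //= s <-; apply: ev_ext => j _; rewrite gE !ev_gop !gE.
  by congr (ev _ _ + _); lia.
have lf : linear f by apply: mk_linear => j; apply: ev_linear.
have lg : linear g by apply: mk_linear => j; apply: ev_linear.
have inj u : f u = 0 -> g u = 0 -> u = 0.
  move=> fu gu; apply: ev_ext => j _; rewrite ev0 -(odd_double_half j).
  by case: (odd j); rewrite ?add1n ?add0n -?fE -?gE ?fu ?gu ev0.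
have fg d' u : (u \in ggr (vx q V) d') =
    (f u \in ggr (dl _ V) d') && (g u \in ggr (dl _ V) (d' - 1)).
  apply/mem_ggr/andP => [H|[/mem_ggr H1 /mem_ggr H2] j].
    split; apply/mem_ggr => j; rewrite ?fE ?gE.
      by have := H j.*2; congr (_ \in ggr V _); lia.
    by have := H j.*2.+1; congr (_ \in ggr V _); lia.
  rewrite -(odd_double_half j); case: (odd j); rewrite ?add1n ?add0n -?fE -?gE.
    by have := H2 j./2; congr (_ \in ggr V _); lia.
  by have := H1 j./2; congr (_ \in ggr V _); lia.
apply: (dim_split lf lg) => [u|u|u _|a b].
- by rewrite !mem_gker fg -fT => /andP[/andP[-> _] /eqP ->]; rewrite lin0 // eqxx.
- by rewrite !mem_gker fg -gT => /andP[/andP[_ ->] /eqP ->]; rewrite lin0 // eqxx.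
- exact: inj.
- rewrite !mem_gker => /andP[ad /eqP a0] /andP[bd /eqP b0].
  pose u : vx q V := mk q (fun j => if odd j then ev b j./2 else ev a j./2).
  have fu : f u = a.
    apply: ev_ext => j jq; rewrite fE ev_mk odd_double doubleK.
    by rewrite (_ : j.*2 < q)%N //; lia.
  have gu : g u = b.
    apply: ev_ext => j jq; rewrite gE ev_mk /= odd_double uphalf_double.
    by rewrite (_ : j.*2.+1 < q)%N //; lia.
  exists u; last by [].
  rewrite mem_gker fg fu gu ad bd; apply/eqP/inj; first by rewrite fT fu.
  by rewrite gT gu.
Qed.

Lemma ev_iter_dl2 V m (u : dl 2 V) j : ev (iter m.+1 (gop (dl 2 V)) u) j =
  iter m.+1 (gop V) (ev u j) + m.+1%:R *: iter m (gop V) (ev u j.+1).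
Proof.
rewrite ev_iter_ext big_ord_recl big_ord_recl big1 => [|i _].
  by rewrite addr0 !lift0 /= muln0 addn0 bin0 muln1 addn1 bin1 subn1 scaler_nat mulr1n.
rewrite ev_ge; last by rewrite !lift0; lia.
by rewrite (lin0 (@iterg_linear _ V _)) mul0rn.
Qed.

(** Clebsch-Gordan for a string of length two. Writing [u = (u0, u1)], the kernel condition says
    that [T^(m+1) u0 + (m+1) T^m u1] and [T^(m+1) u1] vanish. The coordinates [u0] and
    [T u0 + (m+1) u1] then range independently over the kernels of [T^(m+2)] and [T^m]; recovering
    [u1] from them requires dividing by [m + 1]. *)
Lemma cok_dl2 m V d : m.+1%:R != 0 :> k ->
  cok m.+1 (dl 2 V) d = (cok m.+2 V d + cok m V (d - 2))%N.
Proof.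
move=> m0; pose f (u : dl 2 V) := ev u 0.
pose g (u : dl 2 V) := gop V (ev u 0) + m.+1%:R *: ev u 1.
have mem u : (u \in gker m.+1 (dl 2 V) d) = [&& ev u 0 \in ggr V d, ev u 1 \in ggr V (d - 2),
    iter m.+1 (gop V) (ev u 0) + m.+1%:R *: iter m (gop V) (ev u 1) == 0 &
    iter m.+1 (gop V) (ev u 1) == 0].
  rewrite mem_gker -ev_iter_dl2; apply/andP/and4P => [[/mem_ggr ud /eqP Tu]|[u0 u1 T0 T1]].
    split; first by have := ud 0%N; congr (_ \in ggr V _); lia.
    - by have := ud 1%N; congr (_ \in ggr V _); lia.
    - by rewrite Tu ev0.
    - have := ev_iter_dl2 m u 1; rewrite Tu ev0 (@ev_ge _ _ _ u 2) //.
      by rewrite (lin0 (@iterg_linear _ V _)) scaler0 addr0 => <-.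
  split; first apply/mem_ggr => -[|[|j]].
  - by move: u0; congr (_ \in ggr V _); lia.
  - by move: u1; congr (_ \in ggr V _); lia.
  - by rewrite ev_ge // mem0v.
  apply/eqP/ev_ext => -[|[|j]] //; rewrite ev0 => _; first exact/eqP.
  by rewrite ev_iter_dl2 (eqP T1) ev_ge // (lin0 (@iterg_linear _ V _)) scaler0 addr0.
have iterZ n a u : iter n (gop V) (a *: u) = a *: iter n (gop V) u.
  by apply: linZ; apply: iterg_linear.
have iterD n u v : iter n (gop V) (u + v) = iter n (gop V) u + iter n (gop V) v.
  by apply: linD; apply: iterg_linear.
apply: (@dim_split _ _ _ _ f g).
- exact: ev_linear.
- move=> a u v; rewrite /g (ev_linear 0 a) (ev_linear 1 a) gop_linear !scalerDr.
  by rewrite !scalerA [a * _]mulrC addrACA.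
- move=> u; rewrite mem mem_gker => /and4P[-> _ /eqP E /eqP E1] /=.
  move/(congr1 (gop V)): E; rewrite gop0 gopD gopZ -iterS /= => E.
  by move: E1 E => /= ->; rewrite scaler0 addr0 => ->.
- move=> u; rewrite mem mem_gker => /and4P[u0 u1 E _] /=.
  rewrite memvD ?memvZ ?gop_gr //=.
  by rewrite iterD iterZ -iterSr.
- move=> u _; rewrite /f /g => u0; rewrite u0 gop0 add0r => /eqP.
  rewrite scaler_eq0 (negPf m0) => /eqP u1.
  by apply: ev_ext => -[|[|j]] // _; rewrite ?u0 ?u1 ev0.
- move=> a b; rewrite !mem_gker => /andP[ad /eqP a0] /andP[bd /eqP b0].
  pose c := m.+1%:R^-1 *: (b - gop V a).
  pose u : dl 2 V := mk 2 (fun j => if j is 0%N then a else c).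
  have u0 : ev u 0 = a by rewrite ev_mk.
  have u1 : ev u 1 = c by rewrite ev_mk.
  have Bc : m.+1%:R *: c = b - gop V a by rewrite scalerA divff // scale1r.
  exists u; last by rewrite /f /g u0 u1 Bc addrC subrK.
  have E : iter m (gop V) (b - gop V a) = - iter m.+1 (gop V) a.
    by rewrite (linB _ _ (@iterg_linear _ V m)) b0 sub0r iterSr.
  rewrite mem u0 u1 ad memvZ ?memvB ?gop_gr //= -iterZ Bc E subrr eqxx /=.
  by rewrite /c !iterZ E -scaleN1r !gopZ -!iterS a0 !scaler0.
Qed.

End ExtTheory.

(** * String modules in characteristic p *)

(* For a module over [k[T]/(T^p)] that is a direct sum of strings, each of which
   either has length [p] or is centred at degree [c / 2], these relations hold
   for [F r d], the dimension of the cokernel of [T^r] in degree [d]. Unlike the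
   decomposition itself they are visibly stable under differences. *)
Record good (p : nat) (c : int) (F : nat -> int -> nat) : Prop := Good {
  good_sym : forall d, F p d = F p (c - d);
  good_low : forall (r : nat) (d : int), (r <= p)%N -> d * 2 <= c + r%:Z * 2 ->
    (F r d + F p (d - r%:Z * 2)%R = F r (d - p%:Z * 2)%R + F p d)%N;
  good_high : forall (r : nat) (d : int), (r <= p)%N -> c + r%:Z * 2 <= d * 2 ->
    F r d = F r (c + r%:Z * 2 - p%:Z * 2 - d) }.

Lemma good_eq p c F G : (forall r d, F r d = G r d) -> good p c F -> good p c G.
Proof.
move=> E [H1 H2 H3]; split=> [d|r d rp rd|r d rp rd]; rewrite -!E; first exact: H1.
  exact: H2.
exact: H3.
Qed.

Lemma good_add p c F G : good p c F -> good p c G ->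
  good p c (fun r d => F r d + G r d)%N.
Proof.
move=> [F1 F2 F3] [G1 G2 G3]; split=> [d|r d rp rd|r d rp rd].
- by rewrite F1 G1.
- have := F2 r d rp rd; have := G2 r d rp rd; lia.
- by rewrite (F3 r d) // (G3 r d).
Qed.

Lemma good_sub p c F G H : (forall r d, F r d + G r d = H r d)%N ->
  good p c H -> good p c G -> good p c F.
Proof.
move=> E [H1 H2 H3] [G1 G2 G3]; split=> [d|r d rp rd|r d rp rd].
- have := H1 d; have := G1 d; rewrite -!E; lia.
- have := H2 r d rp rd; have := G2 r d rp rd; rewrite -!E; lia.
- have := H3 r d rp rd; have := G3 r d rp rd; rewrite -!E; lia.
Qed.

Lemma good_shift p c c' F (t : int) : c' = c + t * 2 -> good p c F ->
  good p c' (fun r d => F r (d - t)).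
Proof.
move=> -> [F1 F2 F3]; split=> [d|r d rp rd|r d rp rd].
- by rewrite F1; congr F; lia.
- have -> : d - r%:Z * 2 - t = d - t - r%:Z * 2 by lia.
  have -> : d - p%:Z * 2 - t = d - t - p%:Z * 2 by lia.
  by apply: F2 => //; lia.
- by rewrite (F3 r (d - t)) //; [congr F|]; lia.
Qed.

Section GoodModules.
Variables (k : fieldType) (p : nat) (pk : p \in [pchar k]).
Implicit Types V W : gmod k.

Let p_prime : prime p := pcharf_prime pk.

Definition nilp V := forall u : V, iter p (gop V) u = 0.

Lemma nilp_cok V d : nilp V -> cok p V d = nd V d.
Proof.
move=> nV; congr (\dim _); apply/vspaceP => u.
by rewrite mem_gker nV eqxx andbT.
Qed.

(** The intermediate binomial coefficients vanish in characteristic [p], so [(T + S)^p = T^p + S^p]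
    for the shift [S] by [s]. Both the stability of nilpotency and the Frobenius decomposition rest
    on this. *)
Lemma ev_iter_frob e s q es V (u : ext e s q es V) j :
  ev (iter p (gop (ext e s q es V)) u) j = iter p (gop V) (ev u j) + ev u (j + s * p).
Proof.
rewrite ev_iter_ext big_ord_recl /= subn0 muln0 addn0 bin0 mulr1n; congr (_ + _).
have p0 := prime_gt0 p_prime.
case: p p0 p_prime pk => // p' _ pp pk'; rewrite big_ord_recr /= big1 ?add0r => [|i _].
  by rewrite /bump add1n subnn binn mulr1n.
rewrite -scaler_nat (_ : _%:R = 0 :> k) ?scale0r //; apply/eqP.
by rewrite -(dvdn_pcharf pk') prime_dvd_bin //= ltnS ltn_ord.
Qed.

Lemma nilp_ext e s q es V : (q <= s * p)%N -> nilp V -> nilp (ext e s q es V).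
Proof.
move=> qsp nV u; apply: ev_ext => j _; rewrite ev_iter_frob nV add0r ev0 ev_ge //.
by rewrite (leq_trans qsp) // leq_addl.
Qed.

Lemma cok_dl0 r V d : cok r (dl 0 V) d = 0%N.
Proof. by rewrite cok_dl_sym cok0. Qed.

Lemma cok_dl1 r V d : cok r (dl 1 V) d = cok r V d.
Proof. by rewrite cok_dl_sym cok1_dl. Qed.

(** For [0 < r < p] the exponent is invertible and [cok_dl2] applies. It fails at [r = p], but there
    nilpotency makes the kernel the whole graded piece, whose dimension is simply counted. *)
Lemma good_dl2 c V : nilp V -> good p c (cok^~ V) -> good p (c + 2) (cok^~ (dl 2 V)).
Proof.
move=> nV [/= F1 F2 F3]; have p1 := prime_gt1 p_prime.
have Ep d : cok p (dl 2 V) d = (cok p V d + cok p V (d - 2))%N.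
  rewrite !nilp_cok //; last by apply: nilp_ext => //; rewrite mul1n.
  by rewrite nd_ext !big_ord_recl big_ord0 /= addn0 subr0.
have Er r d : (0 < r < p)%N -> cok r (dl 2 V) d = (cok r.+1 V d + cok r.-1 V (d - 2))%N.
  case: r => //= r rp; rewrite cok_dl2 // -(dvdn_pcharf pk).
  by apply/negP => /dvdn_leq; lia.
split=> /= [d|r d|r d].
- by rewrite !Ep F1 (F1 (d - 2)) addnC; congr addn; congr cok; lia.
- rewrite leq_eqVlt => /predU1P[->|rp] rd.
    by rewrite !Ep addnC.
  case: (posnP r) => [->|r0]; first by rewrite !cok0 !Ep !mul0r !subr0.
  (* The range of [d] allowed for the centre [c + 2] and exponent [r] is exactly the one allowed for
     the centre [c] with [r + 1] at [d] and with [r - 1] at [d - 2]. *)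
  rewrite !Ep !Er ?r0 //.
  have := F2 r.+1 d rp; have := F2 r.-1 (d - 2).
  have -> : d - 2 - r.-1%:Z * 2 = d - r%:Z * 2 by lia.
  have -> : d - r.+1%:Z * 2 = d - r%:Z * 2 - 2 by lia.
  have -> : d - p%:Z * 2 - 2 = d - 2 - p%:Z * 2 by lia.
  move=> H1 H2; have := H1 ltac:(lia) ltac:(lia); have := H2 ltac:(lia); lia.
- rewrite leq_eqVlt => /predU1P[->|rp] rd.
    rewrite !Ep F1 (F1 (d - 2)) addnC; congr addn; congr cok; lia.
  case: (posnP r) => [->|r0]; first by rewrite !cok0.
  rewrite !Er ?r0 // F3 ?(F3 r.-1 (d - 2)); try lia.
  by congr addn; congr cok; lia.
Qed.

(* By [cok_dl2], [dl m.+1 (dl 2 V)] behaves as [dl m.+2 V] plus a shift of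
   [dl m V], whence an induction of step two. *)
Lemma good_dl m c V : nilp V -> good p c (cok^~ V) -> (m <= p)%N ->
  good p (c + m%:Z * 2 - 2) (cok^~ (dl m V)).
Proof.
suff H : (forall V c, nilp V -> good p c (cok^~ V) -> (m <= p)%N ->
    good p (c + m%:Z * 2 - 2) (cok^~ (dl m V))) /\
  (forall V c, nilp V -> good p c (cok^~ V) -> (m.+1 <= p)%N ->
    good p (c + m.+1%:Z * 2 - 2) (cok^~ (dl m.+1 V))) by case: H => H _; apply: H.
elim: m => [|m [IH0 IH1]] {V c}; split=> // V c nV gV mp.
- by split=> *; rewrite !cok_dl0.
- have -> : c + 1%:Z * 2 - 2 = c by lia.
  by apply: good_eq gV => r d; rewrite cok_dl1.
- have E r d : (cok r (dl m.+2 V) d + cok r (dl m V) (d - 2) = cok r (dl m.+1 (dl 2 V)) d)%N.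
    (* The symmetry makes [m + 1] the exponent instead of [r]; since [m + 1 < p] it is invertible,
       whatever [r] is. *)
    rewrite !(cok_dl_sym r) cok_swap cok_dl2 // -(dvdn_pcharf pk).
    by apply/negP => /dvdn_leq; lia.
  apply: (good_sub E).
    have := IH1 (dl 2 V) (c + 2) _ (good_dl2 nV gV) (ltnW mp).
    by move=> /(_ (nilp_ext _ _)); rewrite mul1n prime_gt1 // => /(_ isT nV); congr good; lia.
  apply: (good_shift _ (IH0 V c nV gV _)); lia.
Qed.

(** For odd [p] the even and odd parts have the same centre: the lengths [uphalf p] and [p./2]
    differ by one, which moves the sum of the extreme degrees by [2], and the shift by one makes up
    for it. *)
Lemma good_vx c V : odd p -> nilp V -> good p c (cok^~ V) ->
  good p (c + p%:Z - 1) (cok^~ (vx p V)).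
Proof.
move=> op nV gV.
apply: (good_eq (F := fun r d => cok r (dl (uphalf p) V) d + cok r (dl p./2 V) (d - 1)%R)%N).
  by move=> r d; rewrite cok_vx.
apply: good_add.
  have -> : c + p%:Z - 1 = c + (uphalf p)%:Z * 2 - 2 by lia.
  by apply: good_dl => //; lia.
have g := good_dl (m := p./2) nV gV ltac:(lia).
by apply: (good_shift _ g); lia.
Qed.

End GoodModules.

(** * The box algebras *)

Section Unit.
Variable k : fieldType.

Definition unit_gr (d : int) : {vspace k^o} := if d == 0 then fullv else 0%VS.

Lemma unit_op_linear : linear (fun _ : k^o => 0 : k^o).
Proof. by move=> a u v; rewrite scaler0 addr0. Qed.

Lemma unit_op_gr d (u : k^o) : u \in unit_gr d -> (0 : k^o) \in unit_gr (d - 2).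
Proof. by rewrite mem0v. Qed.

Definition unitg : gmod k := GMod unit_op_linear unit_op_gr.

(* [qm q N] is the graded dual of [k[x_1..x_N]/(x_1^q..x_N^q)], its operator
   being dual to the multiplication by [x_1^2 + .. + x_N^2]. *)
Fixpoint qm (q N : nat) : gmod k := if N is N'.+1 then vx q (qm q N') else unitg.

Lemma nd_unit d : nd unitg d = (d == 0).
Proof.
rewrite /nd /unitg /ggr /unit_gr; case: eqP => _; last by rewrite dimv0.
by rewrite dimvf.
Qed.

Lemma cok_unit r d : cok r unitg d = (d == 0) && (0 < r)%N.
Proof.
case: r => [|r]; first by rewrite cok0 andbF.
rewrite andbT -nd_unit; congr (\dim _); apply/vspaceP => u; rewrite mem_gker.
by rewrite [X in X == 0](_ : _ = 0) ?eqxx ?andbT // /iter; case: r.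
Qed.

Lemma good_unit p : (0 < p)%N -> good p 0 (cok^~ unitg).
Proof. by move=> p0; split=> [d|r d rp|r d rp]; rewrite !cok_unit; lia. Qed.

Lemma good_qm p N : p \in [pchar k] -> odd p ->
  nilp p (qm p N) /\ good p (N%:Z * (p%:Z - 1)) (cok^~ (qm p N)).
Proof.
move=> pk op; have p0 := prime_gt0 (pcharf_prime pk).
elim: N => [|N [nN gN]] /=.
  split; last by rewrite mul0r; apply: good_unit.
  by move=> u; case: p p0 {pk op}.
split; first by apply: (nilp_ext pk) => //; rewrite mul2n -addnn leq_addl.
have -> : N.+1%:Z * (p%:Z - 1) = N%:Z * (p%:Z - 1) + p%:Z - 1 by lia.
exact: good_vx.
Qed.

Lemma nd_vx q (V : gmod k) d : nd (vx q V) d = (\sum_(i < q) nd V (d - i%:Z))%N.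
Proof. by rewrite nd_ext; apply: eq_bigr => i _; rewrite mul1n. Qed.

(** In a fixed degree one exponent is determined by the other [N - 1]. *)
Lemma nd_qm_le q N d : (nd (qm q N) d <= q ^ N.-1)%N.
Proof.
case: N => [|N]; first by rewrite nd_unit; case: eqP.
elim: N d => [|N IH] d.
  rewrite nd_vx; case: (boolP [exists i : 'I_q, d == i%:Z]) => [/existsP[i /eqP ->]|].
    rewrite (bigD1 i) //= subrr nd_unit eqxx big1 // => j ji; rewrite nd_unit.
    by apply/eqP; rewrite eqb0 subr_eq0; apply: contra ji => /eqP[ij]; apply/eqP/val_inj.
  rewrite negb_exists => /forallP H; rewrite big1 // => i _.
  by rewrite nd_unit subr_eq0 (negPf (H i)).
rewrite /= -/qm nd_vx (leq_trans (leq_sum _ (fun i _ => IH _))) //.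
by rewrite sum_nat_const card_ord -expnS.
Qed.

Lemma cok_add_le t r (V : gmod k) B d : (forall d, cok 1 V d <= B)%N ->
  (cok r V d <= cok (r + t) V d <= cok r V d + t * B)%N.
Proof.
move=> HB; elim: t => [|t IH]; first by rewrite mul0n !addn0 leqnn.
rewrite addnS; have /andP[L U] := IH; have := cok_mono (r + t) V d.
have := cok_succ_le (r + t) V d; have := HB (d - (r + t)%:Z * 2); lia.
Qed.

Lemma cok1_vx_le q (V : gmod k) d : (cok 1 (vx q V) d <= nd V d + nd V (d - 1))%N.
Proof. by rewrite cok_vx !cok1_dl leq_add ?cok_le_nd. Qed.

Definition shiftl q (V : vectType k) (u : {ffun 'I_q -> V}) := mk q (fun j => ev u j.+1).
Definition shiftr q (V : vectType k) (u : {ffun 'I_q -> V}) :=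
  mk q (fun j => if j is i.+1 then ev u i else 0).

Lemma ev_shiftl q (V : vectType k) (u : {ffun 'I_q -> V}) j : ev (shiftl u) j = ev u j.+1.
Proof. by rewrite ev_mk; case: ltnP => // qj; rewrite ev_ge // leqW. Qed.

Lemma iter_shiftl q (V : gmod k) r (u : vx q V) :
  iter r (gop (vx q V)) (shiftl u) = shiftl (iter r (gop (vx q V)) u).
Proof. by elim: r => //= r ->; apply: ev_ext => j _; rewrite ev_shiftl !ev_gop !ev_shiftl. Qed.

Lemma shiftl_linear q (V : vectType k) : linear (@shiftl q V).
Proof. by apply: mk_linear => j; apply: ev_linear. Qed.

Lemma shiftr_linear q (V : vectType k) : linear (@shiftr q V).
Proof.
by apply: mk_linear => -[|j] a u v; [rewrite scaler0 addr0|apply: ev_linear].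
Qed.

(** [shiftl], dual to multiplication by the new variable, commutes with the operator and is
    injective on functions vanishing at [0]; imposing that vanishing costs at most [nd V d]. *)
Lemma cok_vx_le_pred r q (V : gmod k) d :
  (cok r (vx q V) d <= cok r (vx q V) (d - 1) + nd V d)%N.
Proof.
have le := @ev_linear k q V 0.
apply: (@leq_trans (\dim (kerv (fun u : vx q V => ev u 0) (gker r (vx q V) d)) + nd V d)).
  apply: dim_kerv_le => // u.
  by rewrite mem_gker => /andP[/mem_ggr /(_ 0%N)]; rewrite muln0 subr0.
rewrite leq_add2r; apply: (dim_inj_le (f := @shiftl q V) (U1 := gker r (vx q V) (d - 1))) => [|u|u].
- exact: shiftl_linear.
- rewrite (@mem_kerv _ _ _ _ (gker r (vx q V) d) _ le) !mem_gker => /andP[/andP[/mem_ggr ud /eqP Tu] _].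
  apply: (@gkerI _ r (vx q V)); last by rewrite iter_shiftl Tu lin0 //; apply: shiftl_linear.
  apply/mem_ggr => j; rewrite ev_shiftl.
  by have := ud j.+1; congr (_ \in ggr V _); lia.
- rewrite (@mem_kerv _ _ _ _ (gker r (vx q V) d) _ le) => /andP[_ /eqP u0] su; apply: ev_ext => -[|j] _; first by rewrite u0 ev0.
  by rewrite -ev_shiftl su !ev0.
Qed.

(** [shiftr] goes the other way, with two obstructions: it drops the top value, and it may create a
    nonzero value of the [r]-th iterate at [0]. Each of the two added terms pays for making one of
    these vanish. *)
Lemma cok_vx_pred_le r q (V : gmod k) d : (cok r (vx q V) (d - 1) <=
  cok r (vx q V) d + nd V (d - q%:Z) + nd V (d - r%:Z * 2))%N.
Proof.
case: q => [|q].
  rewrite [X in (X <= _)%N](_ : _ = 0%N) //; apply/eqP; rewrite dimv_eq0 -subv0.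
  by apply/subvP => u _; rewrite memv0; apply/eqP/ev_ext.
have le := @ev_linear k q.+1 V q.
set U := gker r (vx q.+1 V) (d - 1); set U1 := kerv (fun u : vx q.+1 V => ev u q) U.
apply: (@leq_trans (\dim U1 + nd V (d - q.+1%:Z))).
  apply: dim_kerv_le => // u; rewrite mem_gker => /andP[/mem_ggr /(_ q) + _].
  by congr (_ \in ggr V _); lia.
rewrite addnAC leq_add2r.
have gr_shiftr u : u \in ggr (vx q.+1 V) (d - 1) -> shiftr u \in ggr (vx q.+1 V) d.
  move=> /mem_ggr ud; apply/mem_ggr => -[|j]; rewrite ev_mk; first by rewrite mem0v.
  case: ifP => _; last exact: mem0v.
  by have := ud j; congr (_ \in ggr V _); lia.
have lT : linear (fun u : vx q.+1 V => ev (iter r (gop (vx q.+1 V)) (shiftr u)) 0).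
  move=> a u v; rewrite (@shiftr_linear q.+1 V a) (@iterg_linear _ (vx q.+1 V) r a).
  exact: (@ev_linear k q.+1 V 0 a).
set f2 := (fun _ => _) in lT; apply: (@leq_trans (\dim (kerv f2 U1) + nd V (d - r%:Z * 2))).
  apply: dim_kerv_le => // u; rewrite (@mem_kerv _ _ _ _ U _ le) mem_gker.
  move=> /andP[/andP[/gr_shiftr/(iterg_gr r)/mem_ggr/(_ 0%N) + _] _].
  by rewrite muln0 subr0.
rewrite leq_add2r; apply: (dim_inj_le (f := @shiftr q.+1 V) (U1 := gker r (vx q.+1 V) d)) => [|u|u].
- exact: shiftr_linear.
- rewrite (@mem_kerv _ _ _ _ U1 _ lT) (@mem_kerv _ _ _ _ U _ le) !mem_gker => /andP[/andP[/andP[ud /eqP Tu] /eqP uq] /eqP T0].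
  apply: (@gkerI _ r (vx q.+1 V)); first exact: gr_shiftr.
  apply: ev_ext => -[|j] _; rewrite ev0 //.
  rewrite -ev_shiftl -iter_shiftl (_ : shiftl _ = u) ?Tu ?ev0 //.
  apply: ev_ext => i; rewrite ltnS leq_eqVlt ev_shiftl ev_mk => /predU1P[->|iq].
    by rewrite ltnn uq.
  by rewrite ltnS iq.
- rewrite (@mem_kerv _ _ _ _ U1 _ lT) (@mem_kerv _ _ _ _ U _ le) => /andP[/andP[_ /eqP uq] _] su; apply: ev_ext => j.
  rewrite ltnS leq_eqVlt => /predU1P[->|jq]; first by rewrite uq ev0.
  have := congr1 (fun v : {ffun 'I_q.+1 -> V} => ev v j.+1) su.
  by rewrite ev_mk ltnS jq => ->; rewrite !ev0.
Qed.

End Unit.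

(** * Frobenius decomposition *)

Definition close (C a b : nat) : Prop := (a <= b + C)%N /\ (b <= a + C)%N.

Lemma closeD C C' a b a' b' : close C a b -> close C' a' b' ->
  close (C + C') (a + a') (b + b').
Proof. by rewrite /close; lia. Qed.

Lemma close_trans C C' a b c : close C a b -> close C' b c -> close (C + C') a c.
Proof. by rewrite /close; lia. Qed.

Lemma close_sym C a b : close C a b -> close C b a.
Proof. by rewrite /close; lia. Qed.

Lemma closeW C C' a b : (C <= C')%N -> close C a b -> close C' a b.
Proof. by rewrite /close; lia. Qed.

Lemma close_sum (I : finType) (P : pred I) (C : nat) (F G : I -> nat) :
  (forall i, P i -> close C (F i) (G i)) ->
  close (\sum_(i | P i) C) (\sum_(i | P i) F i) (\sum_(i | P i) G i).
Proof.
move=> H; split; rewrite -big_split /=; apply: leq_sum => i /H[H1 H2] //.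
Qed.

Lemma close_lip (F : int -> nat) L (e e' : int) m : (forall e, close L (F e) (F (e - 1))) ->
  `|e - e'| <= m%:Z -> close (m * L) (F e) (F e').
Proof.
move=> H; have Hm (t : nat) (d : int) : close (t * L) (F d) (F (d - t%:Z)).
  elim: t d => [|t IH] d; first by rewrite subr0 mul0n; split; rewrite addn0.
  rewrite mulSn; apply: close_trans (H d) _.
  by have := IH (d - 1); congr (close _ _ (F _)); lia.
move=> em; have [d [dm E]] : exists d : nat, (d <= m)%N /\ (e' = e - d%:Z \/ e = e' - d%:Z).
  by exists `|e - e'|%N; split; lia.
apply: (@closeW (d * L)); first by rewrite leq_mul2r dm orbT.
by case: E => ->; [|apply: close_sym]; apply: Hm.
Qed.

Section Frobenius.
Variables (k : fieldType) (p : nat) (pk : p \in [pchar k]).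

Let p_prime : prime p := pcharf_prime pk.
Let p_gt0 : (0 < p)%N := prime_gt0 p_prime.

Let modn_divn i : (i %% p + p * (i %/ p) = i)%N.
Proof. by rewrite mulnC addnC -divn_eq. Qed.

Fixpoint digits (j : nat) : finType :=
  if j is j'.+1 then ('I_p * digits j')%type : finType else unit : finType.

Fixpoint dsum j : digits j -> nat :=
  if j is j'.+1 then fun v => (v.1 + dsum v.2)%N else fun=> 0%N.

(* Splits [k[x]/(x^(pq))] as the sum over [v < p] of [x^v k[y]/(y^q)], [y = x^p],
   in each variable. *)
Fixpoint frob q j : qm k (p * q) j -> digits j -> qm k q j :=
  if j is j'.+1 then fun u v => mk q (fun i => frob (ev u (v.1 + p * i)) v.2)
  else fun u _ => u.

Lemma frob_linear q j (v : digits j) : linear ((@frob q j)^~ v).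
Proof.
elim: j v => [|j IH] //= v a u w; apply/ffunP => i.
by rewrite !ffunE ev_linear IH.
Qed.

Lemma frob0 q j (v : digits j) : @frob q j 0 v = 0.
Proof. exact: (lin0 (@frob_linear q j v)). Qed.

Lemma frobD q j (v : digits j) u w : @frob q j (u + w) v = frob u v + frob w v.
Proof. exact: (linD _ _ (@frob_linear q j v)). Qed.

Lemma ev_frob q j (u : qm k (p * q) j.+1) (v : digits j.+1) i :
  ev (frob u v) i = frob (ev u (v.1 + p * i)) v.2.
Proof.
rewrite ev_mk; case: ltnP => // qi; rewrite ev_ge.
  by rewrite frob0.
by rewrite (leq_trans _ (leq_addl _ _)) // leq_mul2l qi orbT.
Qed.

Lemma frob_iter q j (u : qm k (p * q) j) v :
  frob (iter p (gop (qm k (p * q) j)) u) v = gop (qm k q j) (frob u v).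
Proof.
elim: j u v => [|j IH] u v; first by case: (p) p_gt0.
apply: ev_ext => i _; rewrite ev_frob (ev_iter_frob pk) ev_gop !ev_frob.
rewrite frobD IH addrC; congr (frob (ev u _) _ + _).
by lia.
Qed.

Lemma frob_inj q j (u : qm k (p * q) j) : (forall v, frob u v = 0) -> u = 0.
Proof.
elim: j u => [|j IH] u H; first exact: (H tt).
apply: ev_ext => i _; rewrite ev0; apply: IH => v.
have := H (Ordinal (ltn_pmod i p_gt0), v) => /(congr1 (fun w => ev w (i %/ p))).
by rewrite ev_frob ev0 /= modn_divn.
Qed.

Lemma frob_surj q j (w : digits j -> qm k q j) :
  exists u : qm k (p * q) j, forall v, frob u v = w v.
Proof.
elim: j w => [|j IH] w; first by exists (w tt); case.
have /fin_all_exists[f fP] (i : 'I_(p * q)) : exists u : qm k (p * q) j,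
    forall v, frob u v = ev (w (Ordinal (ltn_pmod i p_gt0), v)) (i %/ p)%N.
  exact: (IH (fun v => ev (w (Ordinal (ltn_pmod i p_gt0), v)) (i %/ p)%N)).
exists (finfun f) => -[v0 v]; apply: ev_ext => i iq; rewrite ev_frob /=.
have ipq : (v0 + p * i < p * q)%N.
  by have := ltn_ord v0; move: iq p_gt0; nia.
rewrite (ev_ord _ (Ordinal ipq)) ffunE fP /=; congr (ev (w (_, _)) _).
  by apply: val_inj; rewrite /= addnC mulnC modnMDl modn_small.
by rewrite addnC mulnC divnMDl // divn_small ?addn0.
Qed.

(** The grading of the box algebra in the variables [y = x^p], each of degree [p]. *)
Definition fgr q j (d : int) : {vspace qm k q j} :=
  if (p%:Z %| d)%Z then ggr (qm k q j) (d %/ p%:Z)%Z else 0%VS.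

Lemma mem_fgr q j d (x : qm k q j.+1) :
  reflect (forall i, ev x i \in fgr q j (d - (p * i)%:Z)) (x \in fgr q j.+1 d).
Proof.
have dE i : (p%:Z %| d - (p * i)%:Z)%Z = (p%:Z %| d)%Z.
  apply/dvdzP/dvdzP => -[y E]; [exists (y + i%:Z)|exists (y - i%:Z)].
    by rewrite mulrDl -E PoszM [i%:Z * _]mulrC subrK.
  by rewrite mulrBl -E PoszM [i%:Z * _]mulrC.
have p0 : p%:Z != 0 by rewrite -lt0n.
have qE y i : ((y * p%:Z - (p * i)%:Z) %/ p%:Z)%Z = y - i%:Z.
  by rewrite -[RHS](mulzK _ p0) mulrBl PoszM [p%:Z * i]mulrC.
rewrite /fgr; case: ifP => [pd|pd].
  have yE := esym (divzK pd); set y := (d %/ _)%Z in yE *.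
  by apply: (iffP (mem_ggr _ _)) => H i; have := H i; rewrite dE pd mul1n yE qE.
rewrite memv0; apply: (iffP eqP) => [-> i|H].
  by rewrite dE pd ev0 mem0v.
by apply: ev_ext => i _; have := H i; rewrite dE pd memv0 => /eqP ->; rewrite ev0.
Qed.

Lemma frob_gr q j d (u : qm k (p * q) j) :
  reflect (forall v, frob u v \in fgr q j (d - (dsum v)%:Z)) (u \in ggr (qm k (p * q) j) d).
Proof.
elim: j d u => [|j IH] d u.
  have E : fgr q 0 d = ggr (qm k (p * q) 0) d.
    rewrite /fgr /ggr /= /unit_gr; case: ifP => [/dvdzP[x ->]|pd].
      by rewrite mulzK -?lt0n // mulf_eq0; case: eqP => //; case: (p) p_gt0.
    by case: eqP pd => // ->; rewrite dvdz0.
  by apply: (iffP idP) => [H v|/(_ tt)]; rewrite /= subr0 E.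
apply: (iffP (mem_ggr _ _)) => H.
  move=> v; apply/mem_fgr => i; rewrite ev_frob.
  have /IH /(_ v.2) := H (v.1 + p * i)%N.
  by congr (_ \in fgr _ _ _); rewrite /=; lia.
move=> i; apply/IH => v.
have /mem_fgr /(_ (i %/ p)%N) := H (Ordinal (ltn_pmod i p_gt0), v).
rewrite ev_frob /= modn_divn.
by congr (_ \in fgr _ _ _); have := divn_eq i p; lia.
Qed.

Lemma cok_frob q j r d : cok (p * r) (qm k (p * q) j) d =
  (\sum_(v : digits j | (p%:Z %| (d - (dsum v)%:Z)%R)%Z)
      cok r (qm k q j) ((d - (dsum v)%:Z)%R %/ p%:Z)%Z)%N.
Proof.
pose U (v : digits j) : {vspace qm k q j} :=
  if (p%:Z %| (d - (dsum v)%:Z)%R)%Z then gker r (qm k q j) ((d - (dsum v)%:Z)%R %/ p%:Z)%Z else 0%VS.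
have iterE s u v : frob (iter (p * s) (gop (qm k (p * q) j)) u) v =
    iter s (gop (qm k q j)) (frob u v).
  by rewrite [(p * s)%N]mulnC; elim: s => // s IH; rewrite mulSn iterD frob_iter IH.
have memU u v : (frob u v \in U v) =
    (frob u v \in fgr q j (d - (dsum v)%:Z)) &&
    (frob (iter (p * r) (gop (qm k (p * q) j)) u) v == 0).
  rewrite /U /fgr iterE; case: ifP => _; first by rewrite mem_gker.
  rewrite memv0; case: eqP => // ->.
  by rewrite (lin0 (@iterg_linear _ (qm k q j) r)) eqxx.
transitivity (\dim (pwv U)); last first.
  by rewrite dim_pwv [RHS]big_mkcond; apply: eq_bigr => v _; rewrite /U; case: ifP => //; rewrite dimv0.
apply: (@dim_bij _ _ _ (fun u => [ffun v => frob u v])) => [a u w|u|u _ u0|w].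
- by apply/ffunP => v; rewrite !ffunE frob_linear.
- rewrite mem_gker mem_pwv => /andP[/frob_gr ud /eqP Tu].
  apply/forallP => v; by rewrite ffunE memU ud Tu frob0 eqxx.
- by apply: frob_inj => v; have /ffunP/(_ v) := u0; rewrite !ffunE.
- rewrite mem_pwv => /forallP wU; have [u uw] := frob_surj w.
  exists u; last by apply/ffunP => v; rewrite ffunE uw.
  have H v : frob u v \in U v by rewrite uw.
  apply: gkerI; first by apply/frob_gr => v; have := H v; rewrite memU => /andP[].
  by apply: frob_inj => v; have := H v; rewrite memU => /andP[_ /eqP].
Qed.

Lemma card_digits j : #|digits j| = (p ^ j)%N.
Proof. by elim: j => [|j IH] /=; rewrite ?card_unit // card_prod card_ord IH expnS. Qed.

Lemma dsum_le j (v : digits j) : (dsum v <= j * p)%N.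
Proof.
elim: j v => [|j IH] // [v0 v] /=; rewrite mulSn leq_add ?IH //.
exact/ltnW/ltn_ord.
Qed.

(** The divisibility condition determines one digit from the others, so [p^j] of the [p^(j+1)] digit
    vectors survive. *)
Lemma sum_digits_dvd j (d : int) (C : nat) :
  (\sum_(v : digits j.+1 | (p%:Z %| (d - (dsum v)%:Z)%R)%Z) C = p ^ j * C)%N.
Proof.
have one (e : int) : (\sum_(i < p | (p%:Z %| (e - i%:Z)%R)%Z) C = C)%N.
  have p0 : p%:Z != 0 by rewrite -lt0n.
  have ei : (`|(e %% p%:Z)%Z| < p)%N.
    by have := ltz_pmod e (_ : 0 < p%:Z); have := modz_ge0 e p0; lia.
  rewrite (big_pred1 (Ordinal ei)) // => i; rewrite /= -eqz_mod_dvd -val_eqE /=.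
  rewrite (modz_small (m := i)); last by rewrite /= ltz_nat ltn_ord.
  by have := modz_ge0 e p0; lia.
rewrite big_mkcond /= -(pair_bigA _ (fun (i : 'I_p) (v : digits j) =>
  if (p%:Z %| (d - (i + dsum v)%N%:Z)%R)%Z then C else 0%N)) /=.
rewrite exchange_big /= (eq_bigr (fun=> C)) => [|v _].
  by rewrite sum_nat_const card_digits.
rewrite -big_mkcond -[RHS](one (d - (dsum v)%:Z)) /=; apply: eq_bigl => i.
by congr (_ %| _)%Z; lia.
Qed.

(** The digit sum is at most [(j + 1) p], so after division by [p] the arguments of [F] spread over
    at most [j + 1] steps; [m] more steps reach [e]. *)
Lemma frob_sum_close j (F : int -> nat) L (d e : int) m :
  (forall e, close L (F e) (F (e - 1))) -> `|(d %/ p%:Z)%Z - e| <= m%:Z ->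
  close (p ^ j * ((j.+1 + m) * L))
    (\sum_(v : digits j.+1 | (p%:Z %| (d - (dsum v)%:Z)%R)%Z) F ((d - (dsum v)%:Z)%R %/ p%:Z)%Z)
    (p ^ j * F e).
Proof.
move=> lipF em; rewrite -!(sum_digits_dvd j d); apply: close_sum => v pdv.
apply: close_lip => //; have := dsum_le v.
set w := dsum v in pdv *; move: pdv => /dvdzP[x E]; rewrite E mulzK; last by rewrite -lt0n.
have p0 : p%:Z != 0 by rewrite -lt0n.
move: em; have -> : d = x * p%:Z + w%:Z by lia.
rewrite divzMDl // divz_nat => em wj.
have : (w %/ p <= j.+1)%N by rewrite -(mulnK j.+1 p_gt0) leq_div2r.
move: (w %/ p)%N em => y em yj; clear -em yj; lia.
Qed.

End Frobenius.

Lemma half_odd_mul p q : odd p -> odd q ->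
  (p * uphalf q = uphalf (p * q) + p./2)%N /\ ((p * q)./2 = p * q./2 + p./2)%N.
Proof.
move=> op oq.
have [a ->] : exists a, p = (2 * a + 1)%N by exists p./2; lia.
have [b ->] : exists b, q = (2 * b + 1)%N by exists q./2; lia.
have -> : ((2 * a + 1) * (2 * b + 1) = 2 * (2 * (a * b) + a + b) + 1)%N by ring.
have E x : uphalf (2 * x + 1) = x.+1 /\ (2 * x + 1)./2 = x by lia.
by rewrite !(proj1 (E _)) !(proj2 (E _)); split; ring.
Qed.

(** * Lipschitz bounds and the Frobenius step in n + 2 variables *)

Section HilbertBounds.
Variables (k : fieldType) (n : nat) (n_gt0 : (0 < n)%N).

Definition hq q (d : int) := cok 1 (qm k q n.+2) d.

Lemma hq_split q d : hq q d =
  (cok (uphalf q) (qm k q n.+1) d + cok q./2 (qm k q n.+1) (d - 1))%N.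
Proof. by rewrite /hq [LHS]cok_vx !cok1_dl. Qed.

Lemma cok_qm_lip r q d :
  close (2 * q ^ n.-1) (cok r (qm k q n.+1) d) (cok r (qm k q n.+1) (d - 1)).
Proof.
have H := @nd_qm_le k q n; split.
  by apply: leq_trans (cok_vx_le_pred r q (qm k q n) d) _; rewrite leq_add2l mul2n -addnn (leq_trans (H d)) ?leq_addr.
apply: leq_trans (cok_vx_pred_le r q (qm k q n) d) _.
by rewrite -addnA leq_add2l mul2n -addnn leq_add.
Qed.

Lemma cok1_qm_le q d : (cok 1 (qm k q n.+1) d <= 2 * q ^ n.-1)%N.
Proof.
apply: leq_trans (cok1_vx_le q (qm k q n) d) _.
by rewrite mul2n -addnn leq_add ?nd_qm_le.
Qed.

Lemma hq_lip q d : close (4 * q ^ n.-1) (hq q d) (hq q (d - 1)).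
Proof.
rewrite !hq_split; apply: closeW (closeD (cok_qm_lip _ _ _) (cok_qm_lip _ _ _)); lia.
Qed.

Lemma cok_qm_add r t q d :
  close (t * (2 * q ^ n.-1)) (cok r (qm k q n.+1) d) (cok (r + t) (qm k q n.+1) d).
Proof. by have := cok_add_le t r d (@cok1_qm_le q); rewrite /close; lia. Qed.

(** In each parity part, changing the exponent by [p./2] costs at most [p^n q^(n-1)]. The Lipschitz
    bound [2 q^(n-1)], taken [p^n] times, is used over [n + 1] steps in the even part and over
    [n + 2] in the odd part, as [(d - 1) / p] and [d / p - 1], rounded down, can differ by one. In
    total [2 + 2(n + 1) + 2(n + 2) = 4 n + 8]. *)
Lemma hq_frob p q d : p \in [pchar k] -> odd p -> odd q ->
  close ((4 * n + 8) * (p ^ n * q ^ n.-1)) (hq (p * q) d) (p ^ n * hq q (d %/ p%:Z)%Z).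
Proof.
move=> pk op oq; have p_gt0 := prime_gt0 (pcharf_prime pk).
have half r e d' m : `|(d' %/ p%:Z)%Z - e| <= m%:Z ->
    close (p ^ n * ((n.+1 + m) * (2 * q ^ n.-1))) (cok (p * r) (qm k (p * q) n.+1) d')
      (p ^ n * cok r (qm k q n.+1) e).
  move=> em; rewrite (cok_frob pk).
  by apply: (@frob_sum_close _ _ pk n (cok r (qm k q n.+1))) => // e'; apply: cok_qm_lip.
set e := (d %/ p%:Z)%Z; rewrite !hq_split mulnDr.
have B := half (uphalf q) e d 0%N _; have {half} B' := half q./2 (e - 1) (d - 1) 1%N _.
have [U V] := half_odd_mul op oq.
have := close_trans (cok_qm_add (uphalf (p * q)) p./2 (p * q) d).
rewrite -U => /(_ _ _ (B _)) B1.
have := close_trans (close_sym (cok_qm_add (p * q./2) p./2 (p * q) (d - 1))).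
rewrite -V => /(_ _ _ (B' _)) B2.
have {B1}B1 := B1 ltac:(by rewrite subrr).
apply: closeW (closeD B1 (B2 _)).
  rewrite expnMn; have -> : (p ^ n = p * p ^ n.-1)%N by rewrite -expnS prednK.
  set x := (p ^ n.-1)%N; set y := (q ^ n.-1)%N.
  have : (p./2 * (x * y) * 2 <= p * x * y)%N.
    by rewrite -mulnA [(x * y * 2)%N]mulnC mulnA -[(p * x * y)%N]mulnA leq_mul2r; lia.
  by set z := (x * y)%N; rewrite -!mulnA -/z; nia.
have p0 : p%:Z != 0 by rewrite -lt0n.
rewrite /e; have := divz_eq d p%:Z; have := divz_eq (d - 1) p%:Z.
have := modz_ge0 d p0; have := modz_ge0 (d - 1) p0.
have := ltz_pmod d (_ : 0 < p%:Z); have := ltz_pmod (d - 1) (_ : 0 < p%:Z).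
set a := (d %/ _)%Z; set b := (_ %/ _)%Z; set u := (d %% _)%Z; set v := (_ %% _)%Z.
move=> /(_ p_gt0) vp /(_ p_gt0) up v0 u0 E1 E2.
have E : (a - b) * p%:Z = v - u + 1 by rewrite mulrBl; lia.
have : (a - b) = 0 \/ a - b = 1 by nia.
lia.
Qed.

End HilbertBounds.

(** * Macaulay duality *)

Section Coefficients.
Variables (k : fieldType) (q : nat).

Fixpoint coefq N : qm k q N -> seq nat -> k :=
  if N is N'.+1 then fun u s => coefq (ev u (head 0%N s)) (behead s) else fun u _ => u.

Fixpoint mkq N (f : seq nat -> k) : qm k q N :=
  if N is N'.+1 then mk q (fun a => mkq N' (fun s => f (a :: s))) else f [::].

Definition incr2 (s : seq nat) (i : nat) := set_nth 0%N s i (nth 0%N s i + 2).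

Lemma coefq_linear N s : linear ((@coefq N)^~ s : qm k q N -> k^o).
Proof.
by elim: N s => [|N IH] s a u v //=; rewrite ev_linear IH.
Qed.

Lemma coefq0 N s : @coefq N 0 s = 0.
Proof. exact: (lin0 (@coefq_linear N s)). Qed.

Lemma coefqD N s u v : @coefq N (u + v) s = coefq u s + coefq v s.
Proof. exact: (linD _ _ (@coefq_linear N s)). Qed.

Lemma coefq_mkq N f s : size s = N ->
  coefq (mkq N f) s = if all (fun a => a < q)%N s then f s else 0.
Proof.
elim: N f s => [|N IH] f [|a s] //= [sN]; rewrite ev_mk; case: ltnP => _ /=.
  by rewrite IH.
by rewrite coefq0.
Qed.

Lemma mkq_linear (W : vectType k) N (F : W -> seq nat -> k) :
  (forall s, linear (F^~ s : W -> k^o)) -> linear (fun w => mkq N (F w)).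
Proof.
elim: N F => [|N IH] F lF a u v /=; first exact: lF.
apply: (@mk_linear k q (qm k q N) W (fun w a => mkq N (fun s => F w (a :: s)))) => j.
by apply: IH => s; apply: lF.
Qed.

Lemma coefq_ext N (u v : qm k q N) :
  (forall s, size s = N -> coefq u s = coefq v s) -> u = v.
Proof.
elim: N u v => [|N IH] u v H; first exact: (H [::]).
by apply: ev_ext => j _; apply: IH => s sN; apply: (H (j :: s)); rewrite /= sN.
Qed.

Lemma coefq_ge N (u : qm k q N) s : size s = N ->
  ~~ all (fun a => a < q)%N s -> coefq u s = 0.
Proof.
elim: N u s => [|N IH] u [|a s] //= [sN]; rewrite negb_and -leqNgt.
by case/orP => H; [rewrite ev_ge // coefq0|apply: IH].
Qed.

Lemma coefq_gop N (u : qm k q N) s : size s = N ->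
  coefq (gop (qm k q N) u) s = \sum_(i < N) coefq u (incr2 s i).
Proof.
elim: N u s => [|N IH] u [|a s] //; first by rewrite big_ord0.
by move=> [sN]; rewrite big_ord_recl /= ev_gop coefqD IH.
Qed.

Lemma ggr_qmP N (d : int) (u : qm k q N) :
  reflect (forall s, size s = N -> (sumn s)%:Z != d -> coefq u s = 0)
          (u \in ggr (qm k q N) d).
Proof.
elim: N d u => [|N IH] d u.
  rewrite /ggr /= /unit_gr; case: eqP => [->|d0]; [rewrite memvf|rewrite memv0].
    by apply: ReflectT => -[].
  apply: (iffP eqP) => [-> //|/(_ [::])]; apply => //.
  by apply/eqP => /esym.
apply: (iffP (mem_ggr _ _)) => [H [|a s] //= [sN] sd|H j].
  have /IH := H a; apply => //; apply: contra sd => /eqP E; apply/eqP; lia.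
apply/IH => s sN sd; apply: (H (j :: s)) => /=; first by rewrite sN.
by apply: contra sd => /eqP E; apply/eqP; lia.
Qed.

End Coefficients.

Section HilbertFunction.
Variables (k : fieldType) (N q D : nat).

Notation M := (monos N D).
Notation A := (ideal_mx k N q D).

Definition mnm_of (s : seq nat) : multinom N := [multinom nth 0%N s i | i < N].

(** Defined at every monomial and zero outside degree [D], so that shifted exponents need no proof
    that they index a column. *)
Definition colcoef (u : 'cV[k]_#|{: M}|) (m : multinom N) : k :=
  if mdeg m == D then oapp (fun b : M => u (enum_rank b) ord0) 0 (insub m) else 0.

Lemma colcoef_linear m : linear (colcoef^~ m : 'cV[k]_#|{: M}| -> k^o).
Proof.
move=> a u v; rewrite /colcoef; case: ifP => _; last by rewrite scaler0 addr0.
by case: insub => [b|] /=; rewrite ?mxE // scaler0 addr0.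
Qed.

Lemma colcoef_bm u (b : M) : mdeg b = D -> colcoef u b = u (enum_rank b) ord0.
Proof. by move=> bD; rewrite /colcoef bD eqxx valK. Qed.

Lemma mnm_ofK (s : seq nat) : size s = N -> multinom_val (mnm_of s) = s :> seq nat.
Proof.
move=> sN; apply: (@eq_from_nth _ 0%N); first by rewrite size_tuple.
move=> i; rewrite size_tuple => iN.
by rewrite -(tnth_nth 0%N _ (Ordinal iN)) -[LHS]/(mnm_of s (Ordinal iN)) mnmE.
Qed.

Lemma mnm_valKK (m : multinom N) : mnm_of (multinom_val m) = m.
Proof. by apply/mnmP => i; rewrite mnmE -tnth_nth. Qed.

Lemma mdeg_mnm_of s : size s = N -> mdeg (mnm_of s) = sumn s.
Proof. by move=> sN; rewrite /mdeg mnm_ofK // sumnE. Qed.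

Lemma mnm_of_incr2 s (i : 'I_N) : size s = N -> mnm_of (incr2 s i) = (mnm_of s + U_(i) *+ 2)%MM.
Proof.
move=> sN; apply/mnmP => j; rewrite mnmDE mulmnE mnm1E !mnmE /incr2 nth_set_nth /=.
by rewrite -val_eqE /= eq_sym; case: eqP => [->|_]; lia.
Qed.

Lemma size_incr2 s (i : 'I_N) : size s = N -> size (incr2 s i) = N.
Proof. by move=> sN; rewrite size_set_nth sN; apply/maxn_idPr. Qed.

(* The entries of [ideal_mx *m u] are the values of the functional [u] on the
   generators [m * g_j] of the ideal in degree [D]. *)
Lemma ideal_mxP (u : 'cV[k]_#|{: M}|) : A *m u = 0 <->
  (forall m : multinom N, (mdeg m + 2)%N = D ->
     \sum_(i < N) colcoef u (m + U_(i) *+ 2)%MM = 0) /\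
  (forall (m : multinom N) (i : 'I_N), (mdeg m + q)%N = D ->
     colcoef u (m + U_(i) *+ q)%MM = 0).
Proof.
pose L (P : mpoly N k) := \sum_(b : M) mcoeff b P * u (enum_rank b) ord0.
have LX m : mdeg m = D -> L (mpolyX k m) = colcoef u m.
  move=> mD; have mb : (mdeg m < D.+1)%N by rewrite mD.
  rewrite /L (bigD1 (BMultinom mb)) //= big1 ?addr0 => [|b bm].
    by rewrite mcoeffX eqxx mul1r -colcoef_bm.
  by rewrite mcoeffX eq_sym (_ : _ == _ = false) ?mul0r //; apply/negbTE.
have LS (I : finType) (F : I -> mpoly N k) : L (\sum_i F i) = \sum_i L (F i).
  rewrite /L exchange_big; apply: eq_bigr => b _.
  by rewrite (raddf_sum (mcoeff (b : multinom N))) mulr_suml.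
have rowE (j : option 'I_N) (m : M) : (A *m u) (enum_rank (j, m)) ord0 =
    if (mdeg m + gen_deg q j == D)%N then L (mpolyX k m * gen k q j) else 0.
  rewrite mxE /L.
  have -> : forall c : bool, (if c then L (mpolyX k m * gen k q j) else 0) =
      \sum_(b : M) (if c then mcoeff b (mpolyX k m * gen k q j) else 0) * u (enum_rank b) ord0.
    by case=> //; rewrite big1 // => b _; rewrite mul0r.
  rewrite (reindex (@enum_rank _)) /=; last exact/onW_bij/enum_rank_bij.
  by apply: eq_bigr => b _; rewrite mxE !enum_rankK.
have quadE (m : multinom N) : (mdeg m + 2)%N = D ->
    L (mpolyX k m * quadric k N) = \sum_(i < N) colcoef u (m + U_(i) *+ 2)%MM.
  move=> mD; rewrite mulr_sumr LS; apply: eq_bigr => i _.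
  by rewrite mpolyXn -mpolyXD LX // mdegD mdegMn mdeg1 mul1n.
have powE (m : multinom N) i : (mdeg m + q)%N = D ->
    L (mpolyX k m * xvar k i ^+ q) = colcoef u (m + U_(i) *+ q)%MM.
  by move=> mD; rewrite mpolyXn -mpolyXD LX // mdegD mdegMn mdeg1 mul1n.
split=> [Au|[H1 H2]].
  have row0 j (m : multinom N) : (mdeg m + gen_deg q j)%N = D -> L (mpolyX k m * gen k q j) = 0.
    move=> mD; have mb : (mdeg m < D.+1)%N by rewrite ltnS -mD leq_addr.
    by have := rowE j (BMultinom mb); rewrite Au mxE /= mD eqxx => <-.
  by split=> [m mD|m i mD]; [rewrite -quadE //; apply: (row0 None)|rewrite -powE //; apply: (row0 (Some i))].
apply/matrixP => r c; rewrite (ord1 c) -(enum_valK r) [RHS]mxE.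
case: (enum_val r) => -[i|] m; rewrite rowE; case: eqP => //= mD.
  by rewrite powE // H2.
by rewrite quadE // H1.
Qed.

(** The solutions of [A *m u = 0] are the functionals that annihilate the ideal in degree [D],
    together with arbitrary coordinates on the zero columns of lower degree. The map [f] reads off
    the former as functions on the box, [g] the latter, and [U2] counts them. *)
Lemma hilb_cok : hilb k N q D = cok 1 (qm k q N) D%:Z.
Proof.
pose f (u : 'cV[k]_#|{: M}|) : qm k q N := mkq q N (fun s => colcoef u (mnm_of s)).
pose g (u : 'cV[k]_#|{: M}|) : {ffun {: M} -> k^o} :=
  [ffun b : M => if mdeg b == D then 0 else u (enum_rank b) ord0].
pose K := kerv (fun u : 'cV[k]_#|{: M}| => A *m u) fullv.
have lA : linear (fun u : 'cV[k]_#|{: M}| => A *m u).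
  by move=> a u v; rewrite mulmxDr scalemxAr.
have memK u : (u \in K) = (A *m u == 0) by rewrite mem_kerv // memvf.
pose U2 := pwv (fun b : {: M} => if mdeg b == D then 0%VS else @fullv k k^o).
have dimU2 : \dim U2 = (#|{: M}| - #|[set m : M | mdeg m == D]|)%N.
  rewrite dim_pwv -(cardsC [set m : M | mdeg m == D]) addKn -sum1_card.
  rewrite [RHS]big_mkcond /=; apply: eq_bigr => b _; rewrite !inE.
  by case: eqP => _; rewrite ?dimv0 ?dimvf.
have fE u s : u \in K -> size s = N -> coefq (f u) s = colcoef u (mnm_of s).
  (* [mkq] forgets the values outside the box, but there the monomial is divisible by some [x_i^q]
     and the functional is already zero. *)
  rewrite memK => /eqP/ideal_mxP[_ H2] sN; rewrite coefq_mkq //; case: ifPn => //.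
  rewrite -has_predC => /(has_nthP 0%N)[i]; rewrite sN => iN /=; rewrite -leqNgt => qi.
  rewrite /colcoef; case: eqP => // sD.
  have E : mnm_of s = ((mnm_of s - U_(Ordinal iN) *+ q) + U_(Ordinal iN) *+ q)%MM.
    rewrite submK //; apply/mnm_lepP => j; rewrite mulmnE mnm1E mnmE -val_eqE /=.
    by case: eqP => // <-; rewrite mul1n.
  have := H2 (mnm_of s - U_(Ordinal iN) *+ q)%MM (Ordinal iN).
  rewrite -E /colcoef sD eqxx => -> //.
  by rewrite -sD [in RHS]E mdegD mdegMn mdeg1 mul1n.
have splitK : \dim K = (cok 1 (qm k q N) D%:Z + \dim U2)%N.
  apply: (@dim_split _ _ _ _ f g).
  - by apply: mkq_linear => s; apply: colcoef_linear.
  - move=> a u v; apply/ffunP => b; rewrite !ffunE; case: ifP => _.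
      by rewrite scaler0 addr0.
    by rewrite !mxE.
  - move=> u uK; apply: gkerI.
      apply/ggr_qmP => s sN sD; rewrite fE // /colcoef mdeg_mnm_of //.
      by case: eqP => // E; rewrite E eqxx in sD.
    apply: coefq_ext => s sN; rewrite coefq0 /= coefq_gop //.
    rewrite (eq_bigr (fun i : 'I_N => colcoef u (mnm_of s + U_(i) *+ 2)%MM)) => [|i _]; last first.
      by rewrite fE ?size_incr2 // mnm_of_incr2.
    case: (eqVneq (mdeg (mnm_of s) + 2)%N D) => sD.
      by move: uK; rewrite memK => /eqP/ideal_mxP[-> //].
    by rewrite big1 // => i _; rewrite /colcoef mdegD mdegMn mdeg1 mul1n (negPf sD).
  - by move=> u _; rewrite mem_pwv; apply/forallP => b; rewrite ffunE; case: ifP; rewrite ?memvf ?mem0v.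
  - move=> u uK fu gu; apply/matrixP => c c'; rewrite (ord1 c') mxE -(enum_valK c).
    case: (eqVneq (mdeg (enum_val c)) D) => bD.
      rewrite -colcoef_bm // -(mnm_valKK (enum_val c)) -fE ?fu ?coefq0 //.
      by rewrite size_tuple.
    by have /ffunP/(_ (enum_val c)) := gu; rewrite !ffunE (negPf bD).
  - move=> a w; rewrite mem_gker => /andP[/ggr_qmP ad /eqP Ta]; rewrite mem_pwv => /forallP wU.
    pose u : 'cV[k]_#|{: M}| := \col_c (if mdeg (enum_val c : M) == D
      then coefq a (multinom_val (enum_val c : M)) else w (enum_val c)).
    have uE m : colcoef u m = coefq a (multinom_val m).
      rewrite /colcoef; case: eqP => mD.
        have mb : (mdeg m < D.+1)%N by rewrite mD.
        rewrite insubT /= mxE enum_rankK /= mD eqxx //.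
      rewrite ad ?size_tuple // -mdeg_mnm_of ?size_tuple // mnm_valKK.
      by apply/eqP => -[].
    have uK : u \in K.
      rewrite memK; apply/eqP/ideal_mxP; split=> [m mD|m i mD].
        transitivity (coefq (gop (qm k q N) a) (multinom_val m)); last first.
          by rewrite -[gop _ a]/(iter 1 _ a) Ta coefq0.
        rewrite coefq_gop ?size_tuple //; apply: eq_bigr => i _.
        rewrite uE -{1}(mnm_valKK m) -mnm_of_incr2 ?size_tuple // mnm_ofK //.
        by rewrite size_incr2 // size_tuple.
      rewrite uE coefq_ge ?size_tuple // -has_predC; apply/(has_nthP 0%N); exists i.
        by rewrite size_tuple.
      have -> : nth 0%N (multinom_val (m + U_(i) *+ q)%MM) i = (m i + q)%N.
        by rewrite -tnth_nth -[LHS]/((m + U_(i) *+ q)%MM i) mnmDE mulmnE mnm1E eqxx mul1n.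
      by rewrite /= -leqNgt leq_addl.
    exists u => //; split.
      by apply: coefq_ext => s sN; rewrite fE // uE mnm_ofK.
    apply/ffunP => b; rewrite ffunE; have := wU b; case: eqP => bD.
      by rewrite memv0 => /eqP ->.
    by rewrite mxE enum_rankK; move/eqP/negPf: bD => ->.
have := dim_solutions A; rewrite -/K splitK dimU2 /hilb.
have arith (a b c d : nat) : (a <= c)%N -> (b <= c)%N -> (d + (c - a) = c - b)%N ->
  (a - b = d)%N by lia.
by apply: arith => //; [apply: max_card|apply: rank_leq_col].
Qed.

End HilbertFunction.

(** * Hilbert series at the first Frobenius power *)

Section Truncated.
Implicit Types f g h : {poly int}.

(** Congruence modulo [X^M]: power series identities are proved on truncations. *)
Definition eqX (M : nat) f g := forall i, (i < M)%N -> f`_i = g`_i.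

Lemma eqX_trans M g f h : eqX M f g -> eqX M g h -> eqX M f h.
Proof. by move=> fg gh i iM; rewrite fg ?gh. Qed.

Lemma eqX_sym M f g : eqX M f g -> eqX M g f.
Proof. by move=> fg i iM; rewrite fg. Qed.

Lemma eqXMr M f g h : eqX M f g -> eqX M (f * h) (g * h).
Proof.
move=> fg i iM; rewrite !coefM; apply: eq_bigr => j _; rewrite fg //.
by rewrite (leq_ltn_trans _ iM) // -ltnS.
Qed.

Lemma eqXMl M f g h : eqX M f g -> eqX M (h * f) (h * g).
Proof. by rewrite !(mulrC h); apply: eqXMr. Qed.

Lemma eqX_cancel M f g h : f`_0 = 1 -> eqX M (f * g) (f * h) -> eqX M g h.
Proof.
move=> f0 E i; elim/ltn_ind: i => i IH iM; have := E i iM.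
rewrite !coefM !big_ord_recl f0 !mul1r !subn0 => /eqP.
rewrite -subr_eq0 opprD addrACA -sumrB big1 ?addr0 ?subr_eq0 => [/eqP //|j _].
by have ji := ltn_ord j; rewrite lift0 IH ?subrr //; lia.
Qed.

Lemma eqX_comp M f g p : (0 < p)%N -> eqX M f g -> eqX M (f \Po 'X^p) (g \Po 'X^p).
Proof.
move=> p0 fg i iM; rewrite !coef_comp_poly_Xn //; case: ifP => // _.
by apply: fg; rewrite (leq_ltn_trans _ iM) // leq_div.
Qed.

Variable n : nat.
Hypothesis n_gt0 : (0 < n)%N.

(** The Hilbert function of the quadric in [n + 2] variables, whose series is
    [(1 - t^2) / (1 - t)^(n+2)]. *)
Definition Yint (j : nat) : int := 'C(j + n + 1, n + 1)%:Z - 'C(j + n - 1, n + 1)%:Z.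

(** Truncation of [1 / (1 - X)^(j+1)]. *)
Definition binp M j : {poly int} := \poly_(i < M) 'C(i + j, j)%:Z.
Definition Yp M : {poly int} := \poly_(i < M) Yint i.

Lemma binpS M j : eqX M ((1 - 'X) * binp M j.+1) (binp M j).
Proof.
move=> i iM; rewrite mulrBl mul1r coefB coefXM !coef_poly iM.
case: i iM => [|i] iM /=; first by rewrite !binn subr0.
rewrite (ltnW iM) addSn binS; have -> : (i.+1 + j = i + j.+1)%N by lia.
by rewrite PoszD addrAC subrr add0r.
Qed.

Lemma binp0 M : eqX M ((1 - 'X) * binp M 0) 1.
Proof.
move=> i iM; rewrite mulrBl mul1r coefB coefXM !coef_poly iM coef1.
by case: i iM => [|i] iM /=; rewrite ?(ltnW iM) !bin0 ?subr0 ?subrr.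
Qed.

Lemma binp_inv M j : eqX M ((1 - 'X) ^+ j.+1 * binp M j) 1.
Proof.
elim: j => [|j IH]; first by rewrite expr1; apply: binp0.
by rewrite exprSr -mulrA; apply: eqX_trans (eqXMl _ (@binpS M j)) IH.
Qed.

Lemma Yp_inv M : eqX M ((1 - 'X) ^+ n.+2 * Yp M) (1 - 'X^2).
Proof.
apply: (@eqX_trans _ ((1 - 'X) ^+ n.+2 * ((1 - 'X^2) * binp M n.+1))).
  apply: eqXMl => i iM; rewrite mulrBl mul1r coefB coefXnM !coef_poly iM /Yint.
  case: i iM => [|[|i]] iM.
  - by rewrite /= subr0 (@bin_small (0 + n - 1)) ?subr0; [congr ('C(_, _))%:Z|]; lia.
  - by rewrite /= subr0 (@bin_small (1 + n - 1)) ?subr0; [congr ('C(_, _))%:Z|]; lia.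
  - have iM' : (i < M)%N by lia.
    by rewrite subn2 /= iM'; congr (('C(_, _))%:Z - ('C(_, _))%:Z); lia.
rewrite mulrCA -[X in eqX _ _ X]mulr1; apply: eqXMl; exact: binp_inv.
Qed.

End Truncated.

Lemma nd_qm_neg (k : fieldType) q N (d : int) : d < 0 -> nd (qm k q N) d = 0%N.
Proof.
elim: N d => [|N IH] d d0 /=; first by rewrite nd_unit; case: eqP => // d0'; rewrite d0' in d0.
by rewrite nd_vx big1 // => i _; rewrite IH //; lia.
Qed.

Lemma hq_neg (k : fieldType) n q (d : int) : d < 0 -> hq k n q d = 0%N.
Proof.
by move=> d0; apply/eqP; rewrite -leqn0 -(nd_qm_neg k q n.+2 d0) cok_le_nd.
Qed.

Section LowDegrees.
Variables (k : fieldType) (n p : nat) (pk : p \in [pchar k]) (p_odd : odd p).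
Hypothesis n_gt0 : (0 < n)%N.

Let p_gt0 : (0 < p)%N := prime_gt0 (pcharf_prime pk).

Definition geomp : {poly int} := \sum_(i < p) 'X^i.

Lemma coef_geompX N d : (geomp ^+ N)`_d = (nd (qm k p N) d%:Z)%:Z.
Proof.
elim: N d => [|N IH] d; first by rewrite expr0 coef1 nd_unit eqz_nat; case: d.
rewrite exprS mulr_suml coef_sum [in RHS]/= nd_vx.
rewrite (big_morph Posz PoszD (erefl _)); apply: eq_bigr => i _.
rewrite coefXnM; case: ltnP => di; first by rewrite nd_qm_neg //; lia.
by rewrite IH; congr (nd _ _)%:Z; lia.
Qed.

Lemma geompE : (1 - 'X) * geomp = 1 - 'X^p.
Proof. by rewrite -opprB mulNr -subrX1 opprB. Qed.

(** The coefficientwise form of [(1 - t^(2p)) H = (1 - t^2) ((1 - t^p) / (1 - t))^(n+2)]: exact for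
    strings of length [p], while a shorter centred string disturbs it only beyond the stated
    degree. *)
Lemma hq_rec (d : int) : d * 2 <= n.+2%:Z * (p%:Z - 1) + 2 ->
  (hq k n p d + nd (qm k p n.+2) (d - 2) =
   hq k n p (d - p%:Z * 2) + nd (qm k p n.+2) d)%N.
Proof.
move=> dc; have [nN [_ + _]] := good_qm n.+2 pk p_odd.
move=> /(_ 1%N d p_gt0); by rewrite !(nilp_cok _ nN) mul1r => ->.
Qed.

(** In these degrees the kernel of the operator meets only strings of length [p], and those lie
    symmetrically about the centre. *)
Lemma hq_high (d : int) : n.+2%:Z * (p%:Z - 1) + 2 <= d * 2 ->
  hq k n p d = hq k n p (n%:Z * p%:Z - n%:Z - d).
Proof.
move=> dc; have [nN [_ _]] := good_qm n.+2 pk p_odd.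
move=> /(_ 1%N d p_gt0); rewrite mul1r => /(_ dc) E; rewrite /hq E; congr cok; lia.
Qed.

(* The coefficient of [t^D] in [Y(t^p) H(t) = Y(t)], where
   [H = (1 - t^2) / (1 - t^(2p)) * ((1 - t^p) / (1 - t))^(n+2)] and
   [Y = (1 - t^2) / (1 - t)^(n+2)]. *)
Lemma Yint_hq (D : nat) : D%:Z * 2 <= n.+2%:Z * (p%:Z - 1) + 2 ->
  \sum_(j < D.+1) Yint n j * (hq k n p (D%:Z - (p * j)%:Z))%:Z = Yint n D.
Proof.
move=> Dc; pose M := D.+1.
pose H : {poly int} := \poly_(d < M) (hq k n p d%:Z)%:Z.
have HE : eqX M ((1 - 'X^(2 * p)) * H) ((1 - 'X^2) * geomp ^+ n.+2).
  move=> i iM; rewrite !mulrBl !mul1r !coefB !coefXnM !coef_geompX !coef_poly iM.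
  have := hq_rec (d := i) ltac:(lia).
  have -> : (if (i < 2)%N then 0 else (nd (qm k p n.+2) (i - 2)%N)%:Z) =
      (nd (qm k p n.+2) (i%:Z - 2))%:Z.
    case: ltnP => i2; first by rewrite nd_qm_neg //; lia.
    by congr (nd _ _)%:Z; lia.
  have -> : (if (i < 2 * p)%N then 0 else if (i - 2 * p < M)%N then
      (hq k n p (i - 2 * p)%N)%:Z else 0) = (hq k n p (i%:Z - p%:Z * 2))%:Z.
    case: ltnP => i2; first by rewrite hq_neg //; lia.
    by rewrite (leq_ltn_trans (leq_subr _ _) iM); congr (hq _ _ _ _)%:Z; lia.
  lia.
have YpE : eqX M ((1 - 'X^p) ^+ n.+2 * (Yp n M \Po 'X^p)) (1 - 'X^(2 * p)).
  have := eqX_comp p_gt0 (Yp_inv n_gt0 (M := M)).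
  by rewrite rmorphM !(rmorphXn, rmorphB, rmorph1) /= comp_polyX -exprM mulnC.
have : eqX M ((Yp n M \Po 'X^p) * H) (Yp n M).
  (* Multiplied by both denominators, each side becomes [(1 - X^2) (1 - X^p)^(n+2)]. *)
  apply: (@eqX_cancel _ ((1 - 'X) ^+ n.+2 * (1 - 'X^p) ^+ n.+2)).
    rewrite -horner_coef0 hornerM !horner_exp !hornerD !hornerN hornerC hornerX hornerXn.
    by rewrite expr0n (gtn_eqF p_gt0) oppr0 addr0 !expr1n mulr1.
  rewrite -mulrA [(1 - 'X^p) ^+ _ * _]mulrA.
  apply: eqX_trans (eqXMl _ (eqXMr _ YpE)) _.
  apply: eqX_trans (eqXMl _ HE) _.
  rewrite mulrCA -exprMn geompE mulrC -[_ * Yp n M]mulrA mulrCA.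
  apply: eqXMl; apply: eqX_sym; exact: Yp_inv.
move=> /(_ D (ltnSn D)); rewrite coef_poly ltnSn => <-.
rewrite /Yp poly_def rmorph_sum mulr_suml coef_sum; apply: eq_bigr => j _ /=.
rewrite comp_polyZ rmorphXn /= comp_polyX -exprM -scalerAl coefZ coefXnM coef_poly.
congr (_ * _); move: (p * j)%N => x; case: ltnP => Dj; first by rewrite hq_neg //; lia.
by rewrite ltnS leq_subr subzn.
Qed.

End LowDegrees.

(** * Limit as p tends to infinity *)

Section Asymptotics.
Variable R : realType.
Implicit Types (u v : nat -> R) (l m : R).

Definition O1 u l := exists (C : R) (P : nat),
  0 <= C /\ forall p, prime p -> odd p -> (P <= p)%N -> `|u p - l| <= C / p%:R.

Lemma O1_cst l : O1 (fun=> l) l.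
Proof.
by exists 0, 0%N; split=> // p _ _ _; rewrite subrr normr0 mul0r.
Qed.

Lemma O1_close (C : R) (P : nat) u v l :
  (forall p, prime p -> odd p -> (P <= p)%N -> `|u p - v p| <= C / p%:R) -> O1 v l -> O1 u l.
Proof.
move=> H [C' [P' [C'0 H']]]; exists (`|C| + C'), (maxn P P'); split=> [|p pp op].
  by rewrite addr_ge0.
rewrite geq_max => /andP[Pp P'p]; rewrite -(subrKA (v p)) mulrDl.
rewrite (le_trans (ler_normD _ _)) // lerD ?H' // (le_trans (H p pp op Pp)) //.
by rewrite ler_wpM2r ?invr_ge0 // ler_norm.
Qed.

Lemma O1_eq (P : nat) u v l :
  (forall p, prime p -> odd p -> (P <= p)%N -> u p = v p) -> O1 v l -> O1 u l.
Proof.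
move=> E; apply: (@O1_close 0 P) => p pp op Pp.
by rewrite E // subrr normr0 mul0r.
Qed.

Lemma O1D u v l m : O1 u l -> O1 v m -> O1 (fun p => u p + v p) (l + m).
Proof.
move=> [C [P [C0 H]]] [C' [P' [C'0 H']]]; exists (C + C'), (maxn P P'); split=> [|p pp op].
  exact: addr_ge0.
rewrite geq_max => /andP[Pp P'p]; rewrite opprD addrACA mulrDl.
by rewrite (le_trans (ler_normD _ _)) // lerD ?H ?H'.
Qed.

Lemma O1M u v l m : O1 u l -> O1 v m -> O1 (fun p => u p * v p) (l * m).
Proof.
move=> [C [P [C0 H]]] [C' [P' [C'0 H']]].
exists ((`|l| + C) * C' + C * `|m|), (maxn P P'); split=> [|p pp op].
  by rewrite addr_ge0 ?mulr_ge0 ?addr_ge0.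
rewrite geq_max => /andP[Pp P'p]; have := H p pp op Pp; have := H' p pp op P'p.
have p1 : 1 <= p%:R :> R by rewrite ler1n prime_gt0.
have p0 : 0 < p%:R :> R by rewrite (lt_le_trans _ p1).
move=> Hv Hu; have -> : u p * v p - l * m = u p * (v p - m) + (u p - l) * m by ring.
rewrite [leRHS]mulrDl (le_trans (ler_normD _ _)) // !normrM lerD //.
  rewrite -mulrA ler_pM // -(subrK l (u p)) (le_trans (ler_normD _ _)) // addrC lerD2l.
  by rewrite (le_trans Hu) // ler_pdivrMr // ler_peMr.
by rewrite mulrAC ler_wpM2r.
Qed.

Lemma O1Z (c : R) u l : O1 u l -> O1 (fun p => c * u p) (c * l).
Proof. exact/O1M/O1_cst. Qed.

Lemma O1B u v l m : O1 u l -> O1 v m -> O1 (fun p => u p - v p) (l - m).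
Proof.
move=> Hu Hv; have := O1D Hu (O1Z (-1) Hv); rewrite mulN1r.
by apply: (@O1_eq 0) => p _ _ _; rewrite mulN1r.
Qed.

Lemma O1_sum a b (u : nat -> nat -> R) (l : nat -> R) :
  (forall i, (a <= i < b)%N -> O1 (u i) (l i)) ->
  O1 (fun p => \sum_(a <= i < b) u i p) (\sum_(a <= i < b) l i).
Proof.
elim: b => [|b IH] H.
  by rewrite big_geq //; apply: (O1_eq (P := 0)) (O1_cst 0) => p _ _ _; rewrite big_geq.
case: (leqP a b) => ab; last first.
  by rewrite big_geq //; apply: (O1_eq (P := 0)) (O1_cst 0) => p _ _ _; rewrite big_geq.
rewrite big_nat_recr //=; apply: (O1_eq (P := 0)) => [p _ _ _|]; first by rewrite big_nat_recr.
apply: O1D; last by apply: H; rewrite ab ltnSn.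
by apply: IH => i /andP[ai ib]; apply: H; rewrite ai ltnW.
Qed.

Lemma O1_prod b (u : nat -> nat -> R) (l : R) :
  (forall i, (i < b)%N -> O1 (u i) l) -> O1 (fun p => \prod_(i < b) u i p) (l ^+ b).
Proof.
elim: b => [|b IH] H.
  by apply: (O1_eq (P := 0)) (O1_cst 1) => p _ _ _; rewrite big_ord0.
rewrite exprSr; apply: (O1_eq (P := 0)) => [p _ _ _|]; first by rewrite big_ord_recr.
by apply: O1M; [apply: IH => i ib; apply: H; apply: ltnW|apply: H].
Qed.

Section Polys.
Variable n : nat.

Lemma size_Glist (b : R -> R) s j : size (Glist n b s j) = j.+1.
Proof. by elim: j => //= j IH; rewrite size_rcons IH. Qed.

Lemma nth_Glist (b : R -> R) s j i : (i <= j)%N ->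
  nth (fun=> 0) (Glist n b s j) i = Gfun n b s i.
Proof.
elim: j => [|j IH]; first by rewrite leqn0 => /eqP ->.
rewrite leq_eqVlt => /predU1P[->//|ij].
by rewrite /= nth_rcons size_Glist ij IH.
Qed.

(** Recovers the course-of-values recursion, which [Glist] makes structural by carrying all earlier
    members. *)
Lemma GfunE (b : R -> R) s j x : Gfun n b s j x =
  b x - \sum_(1 <= k < j.+1) Ycoef R n k * Gfun n b s (j - k)%N (x + s * k%:R).
Proof.
case: j => [|j]; first by rewrite big_geq // subr0.
rewrite {1}/Gfun /= nth_rcons size_Glist ltnn eqxx; congr (_ - _).
apply: eq_big_nat => i /andP[i1 ij]; rewrite nth_Glist //; lia.
Qed.

Lemma Zpoly_rec i x : Zpoly n i x = 2 * x ^+ n / n`!%:R -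
  \sum_(1 <= j < i.+1) Ycoef R n j * Zpoly n (i - j) (x - j%:R).
Proof.
rewrite /Zpoly GfunE; congr (_ - _); apply: eq_bigr => j _.
by rewrite mulN1r.
Qed.

(** The substitution [x -> n - x] exchanges the leading terms of the two families and reverses the
    direction of the shifts. *)
Lemma Lpoly_Zpoly i (x : R) : Lpoly n i x = Zpoly n (n.-1 - i) (n%:R - x).
Proof.
rewrite /Lpoly /Zpoly; move: (n.-1 - i)%N => j.
elim/ltn_ind: j x => j IH x; rewrite !GfunE; congr (_ - _).
apply: eq_big_nat => h /andP[h1 hj]; congr (_ * _).
rewrite mul1r mulN1r IH; last by lia.
by congr (Gfun _ _ _ _ _); rewrite opprD addrA.
Qed.

(** The one extra summand of the longer recursion is a multiple of [Z_0(0) = 0]. This gluing at the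
    integers is needed because the reflection [x -> n - x] exchanges the open and closed ends of the
    intervals. *)
Lemma Zpoly_cont i : (0 < n)%N -> Zpoly n i.+1 (i.+1%:R : R) = Zpoly n i (i.+1%:R).
Proof.
move=> n0; elim/ltn_ind: i => i IH; rewrite !Zpoly_rec; congr (_ - _).
rewrite big_nat_recr //= subnn subrr.
have -> : Zpoly n 0 (0 : R) = 0.
  by rewrite Zpoly_rec big_geq // subr0 expr0n (gtn_eqF n0) mulr0 mul0r.
rewrite mulr0 addr0; apply: eq_big_nat => h /andP[h1 hi]; congr (_ * _).
have -> : (i.+1 - h = (i - h).+1)%N by lia.
have -> : i.+1%:R - h%:R = (i - h).+1%:R :> R by rewrite -natrB ?subSn // ltnW.
by apply: IH; lia.
Qed.

End Polys.

End Asymptotics.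

(** * The limit at the first Frobenius power *)

Section FirstFrobenius.
Variables (R : realType) (k : nat -> fieldType) (n : nat).
Hypothesis kp : forall p, prime p -> odd p -> p \in [pchar (k p)].
Hypothesis n_ge3 : (3 <= n)%N.

Let n_gt0 : (0 < n)%N := ltnW (ltnW n_ge3).

Definition fl (x : R) (p : nat) : int := Num.floor (x * p%:R).

Lemma fl_itv x p : (fl x p)%:~R <= x * p%:R < (fl x p)%:~R + 1.
Proof. by have := floor_itv (x * p%:R); rewrite intrD. Qed.

Lemma flB x p j : fl (x - j%:R) p = fl x p - (p * j)%:Z.
Proof.
apply: floor_def; have := fl_itv x p; rewrite !rmorphD /= rmorphN /=.
rewrite -[(p * j)%:Z%:~R]/((p * j)%:R) natrM; lra.
Qed.

Lemma O1_fl x (c : R) : O1 (fun p => ((fl x p)%:~R + c) / p%:R) x.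
Proof.
exists (1 + `|c|), 0%N; split=> [|p pp _ _]; first by rewrite addr_ge0.
have p0 : p%:R != 0 :> R by rewrite pnatr_eq0 -lt0n prime_gt0.
rewrite -{2}(mulfK p0 x) -mulrBl normrM [`|p%:R^-1|]ger0_norm ?invr_ge0 //.
rewrite ler_wpM2r ?invr_ge0 // addrAC (le_trans (ler_normD _ _)) // lerD2r.
have := fl_itv x p; rewrite ler_norml; lra.
Qed.

Lemma binR j t : (n.-1 <= t)%N ->
  'C(j + t, n)%:R = (\prod_(i < n) (j%:R + (t - i)%:R)) / n`!%:R :> R.
Proof.
move=> nt; apply: (@mulIf _ n`!%:R); first by rewrite pnatr_eq0 -lt0n fact_gt0.
rewrite divfK ?pnatr_eq0 -?lt0n ?fact_gt0 // -natrM bin_ffact ffact_prod natr_prod.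
apply: eq_bigr => i _; rewrite -natrD addnBA // (leq_trans _ nt) //.
by rewrite -ltnS prednK.
Qed.

(** Pascal's rule, used twice, gives two polynomials in [j] of degree [n] with leading coefficient
    [1 / n!]: the origin of [2 x^n / n!]. *)
Lemma YintE j : Yint n j = 'C(j + n, n)%:Z + 'C(j + n.-1, n)%:Z.
Proof.
rewrite /Yint !addn1 binS; case: n n_gt0 => // m _.
rewrite addnS subn1 /= [in 'C(_, m.+2)]binS !PoszD; lia.
Qed.

Lemma O1_bin x t : 0 <= x -> (n.-1 <= t)%N ->
  O1 (fun p => 'C(`|fl x p| + t, n)%:R / p%:R ^+ n) (x ^+ n / n`!%:R).
Proof.
move=> x0 nt.
have H : O1 (fun p => n`!%:R^-1 * \prod_(i < n) (((fl x p)%:~R + (t - i)%:R) / p%:R))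
     (n`!%:R^-1 * x ^+ n).
  by apply/O1Z/(O1_prod (u := fun i p => ((fl x p)%:~R + (t - i)%:R) / p%:R)) => i _; apply: O1_fl.
rewrite mulrC; apply: (O1_eq (P := 0)) H => p _ _ _.
rewrite binR // [in RHS]big_split /= prodr_const card_ord exprVn [RHS]mulrA; congr (_ / _).
rewrite [LHS]mulrC; congr (_ * _); apply: eq_bigr => i _; congr (_ + _).
have f0 : 0 <= fl x p by rewrite floor_ge0 mulr_ge0.
by rewrite -[LHS]/((`|fl x p|%N%:Z)%:~R) gez0_abs.
Qed.

Lemma O1_Yint x : 0 <= x ->
  O1 (fun p => (Yint n `|fl x p|)%:~R / p%:R ^+ n) (2 * x ^+ n / n`!%:R).
Proof.
move=> x0; have := O1D (O1_bin x0 (leq_pred n)) (O1_bin x0 (leqnn n.-1)).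
have -> : x ^+ n / n`!%:R + x ^+ n / n`!%:R = 2 * x ^+ n / n`!%:R by ring.
apply: (O1_eq (P := 0)) => p _ _ _.
by rewrite YintE rmorphD /= mulrDl.
Qed.

Lemma sum_nat_supp (F : nat -> R) A M : (A <= M)%N -> (forall j, (A <= j)%N -> F j = 0) ->
  \sum_(0 <= j < M) F j = \sum_(0 <= j < A) F j.
Proof.
move=> AM F0; rewrite (big_cat_nat (leq0n A) AM) //= [X in _ + X](_ : _ = 0) ?addr0 //.
by rewrite big_nat big1 // => j /andP[Aj _]; apply: F0.
Qed.

Lemma low_threshold x : x < (n%:R + 2) / 2 -> exists P : nat, forall p, (0 < p)%N -> (P <= p)%N ->
  fl x p * 2 <= n.+2%:Z * (p%:Z - 1) + 2.
Proof.
move=> xn; have d0 : 0 < n%:R + 2 - 2 * x by lra.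
(* For [x p] in place of its floor, the inequality amounts to [n <= p (n + 2 - 2 x)]. *)
exists (Num.bound (n%:R / (n%:R + 2 - 2 * x))) => p p0 Pp.
have : n%:R / (n%:R + 2 - 2 * x) <= p%:R.
  apply: (le_trans (ltW (archi_boundP _))); last by rewrite ler_nat.
  by rewrite divr_ge0 // ltW.
rewrite ler_pdivrMr // => H.
rewrite -(ler_int R) !(rmorphD, rmorphM, rmorphB, rmorph1) /=.
rewrite -![_%:Z%:~R]/(_%:R) -[n.+2]addn2 natrD; have := fl_itv x p.
move: (fl x p)%:~R H => f; nra.
Qed.

(** After division by [p^n], [Yint_hq] becomes the recursion of the [Z_(-i)]: replacing [d] by
    [d - p j] replaces [x] by [x - j], and the [j = 0] term is the one solved for. *)
Lemma O1_hq_low i x : i%:R <= x < i.+1%:R -> x < (n%:R + 2) / 2 ->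
  O1 (fun p => (hq (k p) n p (fl x p))%:R / p%:R ^+ n) (Zpoly n i x).
Proof.
elim/ltn_ind: i x => i IH x /andP[ix xi] xn.
have x0 : 0 <= x by apply: le_trans ix.
have [P PP] := low_threshold xn.
rewrite Zpoly_rec; apply: (O1_eq (P := P)); last first.
  apply: O1B (O1_Yint x0) _.
  apply: (O1_sum (u := fun j p => Ycoef R n j * ((hq (k p) n p (fl (x - j%:R) p))%:R / p%:R ^+ n)))
    => j /andP[j1 ji].
  apply: O1Z; apply: IH; first by lia.
    by rewrite -natr1 natrB; [move: xi; rewrite -natr1; lra|lia].
  by have : 0 <= j%:R :> R by []; lra.
move=> p pp op Pp; have p0 := prime_gt0 pp.
have f0 : 0 <= fl x p by rewrite floor_ge0 mulr_ge0.
have := PP p p0 Pp; rewrite -[in fl x p * 2](gez0_abs f0).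
move=> /(Yint_hq (kp pp op) op n_gt0) /(congr1 (fun z : int => z%:~R : R)).
rewrite rmorph_sum /= gez0_abs //.
set D := `|fl x p|%N => E.
pose F j : R := Ycoef R n j * (hq (k p) n p (fl x p - (p * j)%:Z))%:R.
have {}E : \sum_(0 <= j < D.+1) F j = (Yint n D)%:~R.
  by rewrite -E big_mkord; apply: eq_bigr => j _; rewrite rmorphM /= rmorphB.
have F0 j : fl x p < (p * j)%:Z -> F j = 0.
  by move=> pj; rewrite /F hq_neg ?mulr0 //; lia.
(* Both ranges are extended to a common one; the terms added have negative degree, hence vanish. *)
have : \sum_(0 <= j < D.+1) F j = \sum_(0 <= j < i.+1) F j.
  rewrite -(@sum_nat_supp F D.+1 (D.+1 + i.+1)) ?leq_addr //; last first.
    move=> j Dj; apply: F0; have : (j <= p * j)%N by rewrite leq_pmull.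
    by move: (p * j)%N => pj; rewrite /D in Dj *; lia.
  rewrite (@sum_nat_supp F i.+1 (D.+1 + i.+1)) ?leq_addl // => j ij; apply: F0.
  rewrite floor_lt_int -[(p * j)%:Z%:~R]/((p * j)%:R) natrM mulrC ltr_pM2l ?ltr0n //.
  by rewrite (lt_le_trans xi) // ler_nat.
have Y0 : Ycoef R n 0 = 1.
  by rewrite /Ycoef add0n binn (@bin_small (0 + n - 1)) ?subr0 //; lia.
rewrite E (@big_ltn _ _ _ 0 i.+1 F) // {1}/F muln0 subr0 Y0 mul1r => ->.
rewrite mulrDl -[LHS]addr0 -addrA; congr (_ + _); apply/esym/eqP.
rewrite subr_eq0 mulr_suml; apply/eqP; apply: eq_bigr => j _.
by rewrite /F flB mulrA.
Qed.

(* The limit function below [(n + 2) / 2]; beyond, it is [Gpoly (n - x)]. *)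
Definition Gpoly (y : R) : R := if y < 0 then 0 else Zpoly n `|Num.floor y| y.

Lemma floor_nat_itv (y : R) : 0 <= y ->
  (`|Num.floor y|%N%:R <= y < `|Num.floor y|%N.+1%:R).
Proof.
move=> y0; have f0 : 0 <= Num.floor y by rewrite floor_ge0.
have := floor_itv y; rewrite -{1 2}(gez0_abs f0) intrD.
by rewrite -[_%:Z%:~R]/(_%:R) -natr1.
Qed.

Lemma O1_hq_Gpoly x : x < (n%:R + 2) / 2 ->
  O1 (fun p => (hq (k p) n p (fl x p))%:R / p%:R ^+ n) (Gpoly x).
Proof.
move=> xn; rewrite /Gpoly; case: ltP => x0; last exact: O1_hq_low (floor_nat_itv x0) xn.
apply: (O1_eq (P := 0)) (O1_cst 0) => p pp op _.
by rewrite hq_neg ?mul0r // floor_lt0 nmulr_rlt0 // ltr0n prime_gt0.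
Qed.

Lemma close_normr (C a b : nat) : close C a b -> `|a%:R - b%:R| <= C%:R :> R.
Proof.
move=> [H1 H2].
have : a%:R <= b%:R + C%:R :> R by rewrite -natrD ler_nat.
have : b%:R <= a%:R + C%:R :> R by rewrite -natrD ler_nat.
rewrite ler_norml; lra.
Qed.

(** The reflected degree differs from the floor of [(n - x) p] by at most [n]; the Lipschitz
    constant [4 p^(n-1)] turns this into the error [4 n / p]. *)
Lemma O1_hq_high x : (n%:R + 2) / 2 <= x ->
  O1 (fun p => (hq (k p) n p (fl x p))%:R / p%:R ^+ n) (Gpoly (n%:R - x)).
Proof.
move=> nx; have n3 : 3 <= n%:R :> R by rewrite (ler_nat R 3).
have yn : n%:R - x < (n%:R + 2) / 2 by lra.
apply: (O1_close (C := (4 * n)%:R) (P := 0)) (O1_hq_Gpoly yn) => p pp op _.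
have p0 : (0 < p)%N := prime_gt0 pp.
have pR0 : 0 < p%:R :> R by rewrite ltr0n.
have I1 := fl_itv x p; have I2 := fl_itv (n%:R - x) p.
have xp : (n%:R + 2) / 2 * p%:R <= x * p%:R by rewrite ler_pM2r.
(* Twice the rounding error is less than [2], which the slack of [n] in the bound [(n + 2) p - n]
   absorbs. *)
have hi : n.+2%:Z * (p%:Z - 1) + 2 <= fl x p * 2.
  suff : n.+2%:Z * p%:Z - 2 < fl x p * 2.
    by rewrite mulrBr mulr1; move: (n.+2%:Z * p%:Z) (fl x p) => a f; clear -n_ge3; lia.
  rewrite -(ltr_int R) !(rmorphD, rmorphM, rmorphN) /=.
  rewrite -![_%:Z%:~R]/(_%:R) -[n.+2]addn2 natrD; move: (fl x p)%:~R I1 => f; lra.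
rewrite (hq_high (kp pp op) op) //.
have E : `|(n%:Z * p%:Z - n%:Z - fl x p) - fl (n%:R - x) p| <= n%:Z.
  have : n%:Z * p%:Z - 2 < fl x p + fl (n%:R - x) p.
    rewrite -(ltr_int R) !(rmorphD, rmorphM, rmorphN) /= -![_%:Z%:~R]/(_%:R).
    by move: (fl x p)%:~R (fl (_ - _) p)%:~R I1 I2 => f g; lra.
  have : fl x p + fl (n%:R - x) p <= n%:Z * p%:Z.
    rewrite -(ler_int R) !(rmorphD, rmorphM, rmorphN) /= -![_%:Z%:~R]/(_%:R).
    by move: (fl x p)%:~R (fl (_ - _) p)%:~R I1 I2 => f g; lra.
  move: (fl x p) (fl (n%:R - x) p) (n%:Z * p%:Z) => a b c; clear -n_ge3; lia.
rewrite -mulrBl normrM [`|_^-1|]ger0_norm ?invr_ge0 ?exprn_ge0 //.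
have := close_normr (close_lip (hq_lip (k p) n_gt0 p) E).
rewrite ler_pdivrMr ?exprn_gt0 // => /le_trans; apply.
rewrite -mulrA -[in p%:R ^+ n](prednK n_gt0) exprS mulKf ?gt_eqF //.
rewrite le_eqVlt; apply/orP; left; apply/eqP; rewrite !natrM natrX; ring.
Qed.

End FirstFrobenius.

(** * Comparison with the piecewise description *)

Section Limit.
Variables (R : realType) (n : nat).
Hypothesis n_ge3 : (3 <= n)%N.

Lemma Gpoly_Zpoly i (x : R) : i%:R <= x <= i.+1%:R -> Gpoly n x = Zpoly n i x.
Proof.
move=> /andP[ix]; rewrite le_eqVlt => /predU1P[->|xi].
  rewrite /Gpoly ltNge ler0n /= -[i.+1%:R]/((i.+1%:Z)%:~R) intrKfloor absz_nat.
  by apply: Zpoly_cont; lia.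
have x0 : 0 <= x by apply: le_trans ix.
rewrite /Gpoly ltNge x0 /= (_ : Num.floor x = i) //; apply: floor_def.
by rewrite ix intrD -[(Posz i)%:~R]/(i%:R) natr1.
Qed.

(** The threshold [(n + 2) / 2] is the integer [n0 + 2] for even [n] and [n0 + 3/2] for odd [n],
    which explains the half-interval in the odd case. Past [n] the argument [n - x] is at most [0],
    where [Gpoly] vanishes. *)
Lemma finfE (x : R) : 0 <= x ->
  finf n x = if x < (n%:R + 2) / 2 then Gpoly n x else Gpoly n (n%:R - x).
Proof.
move=> x0; have n3 : 3 <= n%:R :> R by rewrite (ler_nat R 3).
have G0 : Gpoly n (0 : R) = 0.
  rewrite (@Gpoly_Zpoly 0) ?lexx ?ler01 // Zpoly_rec big_geq // subr0 expr0n.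
  by rewrite (_ : n == 0%N = false) ?mulr0 ?mul0r //; lia.
rewrite /finf; case: (leP n%:R x) => [nx|xn].
  rewrite ltNge (_ : _ <= x) /=; last by lra.
  case: (ltgtP x n%:R) nx => // [nx|->] _; last by rewrite subrr G0.
  by rewrite /Gpoly subr_lt0 nx.
have /andP[ix xi] := floor_nat_itv x0; set i := `|Num.floor x|%N in ix xi *.
have ZE : Zpoly n i x = Gpoly n x by rewrite (@Gpoly_Zpoly i) // ix ltW.
have i_n : (i < n)%N by rewrite -(ltr_nat R); apply: le_lt_trans ix xn.
(* Here [n - x] lies in an interval closed on the right, so the closed form of [Gpoly_Zpoly]
   matters. *)
have LE : Lpoly n i x = Gpoly n (n%:R - x).
  rewrite Lpoly_Zpoly (@Gpoly_Zpoly (n.-1 - i)) //.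
  have -> : (n.-1 - i = n - i.+1)%N by lia.
  by rewrite -[(n - i.+1).+1%:R]natr1 natrB // -[i.+1%:R]natr1; move: xi; rewrite -natr1; lra.
have half : n%:R = 2 * n./2%:R + (odd n)%:R :> R.
  by rewrite -{1}(odd_double_half n) natrD -mul2n natrM addrC.
have up j : (i <= j)%N -> x < j%:R + 1 :> R.
  by move=> ij; apply: lt_le_trans xi _; rewrite natr1 ler_nat.
have dn j : (j < i)%N -> j%:R + 1 <= x :> R.
  by move=> ji; apply: le_trans ix; rewrite natr1 ler_nat.
rewrite ZE LE; case: (boolP (odd n)) half => on /= half; rewrite ?addr0 in half.
  case: (leqP i n./2) => [/up|] im; first by rewrite half ifT //; lra.
  case: eqP => [iE|ne].
    have E : n./2%:R + 1 + 1 / 2 = (n%:R + 2) / 2 :> R by rewrite half; lra.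
    by rewrite -iE ZE LE iE -natr1 E.
  by have := @dn n./2.+1 ltac:(lia); rewrite half -natr1 => H; rewrite ifF //; apply/negbTE; rewrite -leNgt; lra.
have -> : (n./2 - 1).+1 = n./2 by lia.
case: (leqP i n./2) => [/up|/dn] im; first by rewrite half ifT //; lra.
by rewrite half ifF //; apply/negbTE; rewrite -leNgt; lra.
Qed.

(** The range is the one for which [n - x] reaches the reflected branch, where reflecting again
    gives back [x]. *)
Lemma finf_sym (x : R) : 0 <= x <= (n%:R - 2) / 2 -> finf n x = finf n (n%:R - x).
Proof.
move=> /andP[x0 xn]; have n3 : 3 <= n%:R :> R by rewrite (ler_nat R 3).
rewrite !finfE //; last lra.
rewrite ifT; last lra.
rewrite ifF; last by apply/negbTE; rewrite -leNgt; lra.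
by congr Gpoly; ring.
Qed.

Lemma O1_hq_finf (k : nat -> fieldType) (x : R) :
  (forall p, prime p -> odd p -> p \in [pchar (k p)]) -> 0 <= x ->
  O1 (fun p => (hq (k p) n p (fl x p))%:R / p%:R ^+ n) (finf n x).
Proof.
move=> kp x0; rewrite finfE //; case: ltP => xn; first exact: O1_hq_Gpoly.
exact: O1_hq_high.
Qed.

End Limit.

(** * Convergence of the density *)

Section GeometricCauchy.
Variable R : realType.

(* [f s - c r^s] increases and [f s + c r^s] decreases, where [c = K / (1 - r)]. *)
Lemma geometric_cauchy (f : nat -> R) (K r : R) : 0 <= r < 1 -> 0 <= K ->
  (forall s, 0 <= f s) -> (forall s, `|f s.+1 - f s| <= K * r ^+ s) ->
  `|limn f - f 1%N| <= K / (1 - r) * r.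
Proof.
move=> /andP[r0 r1] K0 f0 Hf; have d0 : 0 < 1 - r by rewrite subr_gt0.
set c := K / (1 - r); have cK : c * (1 - r) = K by rewrite divfK ?gt_eqF.
have c0 : 0 <= c by rewrite divr_ge0 // ltW.
have e0 s : 0 <= c * r ^+ s by rewrite mulr_ge0 ?exprn_ge0.
have eS s : c * r ^+ s - c * r ^+ s.+1 = K * r ^+ s by rewrite -cK exprS; ring.
have dec : {homo (fun s => f s + c * r ^+ s) : a b / (a <= b)%N >-> b <= a}.
  apply/nonincreasing_seqP => s; have := Hf s; have := eS s; rewrite ler_norml.
  by move: (c * _) (c * _) (K * _) => a b d; lra.
have inc : {homo (fun s => f s - c * r ^+ s) : a b / (a <= b)%N >-> a <= b}.
  apply/nondecreasing_seqP => s; have := Hf s; have := eS s; rewrite ler_norml.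
  by move: (c * _) (c * _) (K * _) => a b d; lra.
have cw : cvgn (fun s => f s + c * r ^+ s).
  apply: nonincreasing_is_cvgn => //; exists 0 => _ [s _ <-].
  by rewrite addr_ge0.
have cg : cvgn (geometric c r).
  by apply: cvgP; apply: cvg_geometric; rewrite ger0_norm.
have cf : cvgn f.
  have -> : f = (fun s => f s + c * r ^+ s) - geometric c r.
    by apply/funext => s; rewrite !fctE /= addrK.
  exact: is_cvgB cw cg.
have near1 : (\forall s \near \oo, (`|f s - f 1%N| <= c * r)%R)%classic.
  exists 1%N => // s /= s1; have := dec _ _ s1; have := inc _ _ s1; rewrite expr1 ler_norml.
  by have := e0 s; move: (c * _) (c * _) => a b; lra.
rewrite ler_norml lerBlDr lerBrDr; apply/andP; split.
  apply: limr_ge => //; apply: filterS near1 => s; rewrite ler_norml; lra.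
apply: limr_le => //; apply: filterS near1 => s; rewrite ler_norml; lra.
Qed.

End GeometricCauchy.

Section Density.
Variables (R : realType) (k : fieldType) (p n : nat).
Hypotheses (pk : p \in [pchar k]) (p_odd : odd p) (n_gt0 : (0 < n)%N).

Let p_prime : prime p := pcharf_prime pk.
Let p_gt0 : (0 < p)%N := prime_gt0 p_prime.

(** Nested floors collapse exactly, so the Frobenius step compares the same point [x] at both
    levels. *)
Lemma fl_divz (x : R) q : (fl x (p * q) %/ p%:Z)%Z = fl x q.
Proof.
have p0 : p%:Z != 0 by rewrite -lt0n.
apply/esym/floor_def; have := fl_itv x (p * q).
have := divz_eq (fl x (p * q)) p%:Z; have := modz_ge0 (fl x (p * q)) p0.
have := ltz_pmod (fl x (p * q)) (_ : 0 < p%:Z).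
set d := fl x (p * q); set m := (d %/ _)%Z; set r := (d %% _)%Z.
move=> /(_ p_gt0) rp r0 E; have pR : 0 < p%:R :> R by rewrite ltr0n.
have lo : m * p%:Z <= d by rewrite E lerDl.
have hi : d + 1 <= (m + 1) * p%:Z by rewrite mulrDl mul1r; lia.
move: lo hi; rewrite -!(ler_int R) !rmorphM !rmorphD /= -![p%:Z%:~R]/(p%:R) ?natrM => lo hi.
rewrite [p%:R * _]mulrC mulrA => /andP[h1 h2]; apply/andP; split.
  by rewrite -(ler_pM2r pR); lra.
by rewrite -(ltr_pM2r pR); lra.
Qed.

(** By [hq_frob] consecutive normalised values differ by at most [K p^(-s)] with [K = 4 n + 8].
    Starting the comparison at [s = 1] gains the factor [1 / p], and [1 / (1 - 1/p) <= 2] gives the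
    constant. *)
Lemma hk_density_close (x : R) : 0 <= x ->
  `|hk_density k p n x - (hq k n p (fl x p))%:R / p%:R ^+ n| <= (2 * (4 * n + 8))%:R / p%:R.
Proof.
move=> x0.
pose f (s : nat) : R := (hq k n (p ^ s) (fl x (p ^ s)))%:R / (p ^ s)%:R ^+ n.
have -> : hk_density k p n x = limn f.
  rewrite /hk_density (_ : (fun s : nat => _) = f) //; apply/funext => s.
  rewrite /f mulrC; congr (_%:R * _).
  rewrite /hilbR hilb_cok /hq gez0_abs // floor_ge0 mulr_ge0 //.
have p2 : 2 <= p%:R :> R by rewrite (ler_nat R 2) prime_gt1.
have pR : 0 < p%:R :> R by rewrite ltr0n.
have -> : (hq k n p (fl x p))%:R / p%:R ^+ n = f 1%N by rewrite /f expn1.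
pose K : R := (4 * n + 8)%:R.
have r1 : p%:R^-1 < 1 :> R by rewrite invf_lt1 //; lra.
have := @geometric_cauchy R f K p%:R^-1.
rewrite invr_ge0 ltW //= r1 => /(_ isT) /(_ _ _ _); move=> H.
apply: le_trans (H _ _ _) _ => [|s|s|].
- exact: ler0n.
- by rewrite divr_ge0 ?exprn_ge0.
- set q := (p ^ s)%N; have oq : odd q by rewrite oddX p_odd orbT.
  have q0 : (0 < q)%N by rewrite expn_gt0 p_gt0.
  have qR : 0 < q%:R :> R by rewrite ltr0n.
  have := @close_normr R _ _ _ (hq_frob n_gt0 (fl x (p * q)) pk p_odd oq).
  rewrite fl_divz /f expnS -/q => C.
  have -> : (hq k n (p * q) (fl x (p * q)))%:R / (p * q)%:R ^+ n -
      (hq k n q (fl x q))%:R / q%:R ^+ n =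
      ((hq k n (p * q) (fl x (p * q)))%:R - (p ^ n * hq k n q (fl x q))%:R) / (p * q)%:R ^+ n :> R.
    rewrite !natrM natrX exprMn; field.
    by rewrite !expf_neq0 ?gt_eqF.
  rewrite normrM [`|_^-1|]ger0_norm ?invr_ge0 ?exprn_ge0 //.
  rewrite ler_pdivrMr; last by rewrite exprn_gt0 // ltr0n muln_gt0 p_gt0.
  apply: le_trans C _.
  have -> : p%:R^-1 ^+ s = q%:R^-1 :> R by rewrite exprVn /q natrX.
  have E : (p ^ n * q ^ n.-1)%:R = q%:R^-1 * (p * q)%:R ^+ n :> R.
    rewrite -natrX expnMn !natrM mulrCA; congr (_ * _).
    by rewrite -[in RHS](prednK n_gt0) expnS natrM mulKf ?gt_eqF.
  by rewrite natrM E mulrA.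
- rewrite natrM -/K ler_pdivlMr // mulfVK ?gt_eqF // ler_pdivrMr ?subr_gt0 //.
  have : p%:R^-1 <= 2^-1 :> R by rewrite lef_pV2 ?posrE //; lra.
  have : 0 <= K by rewrite ler0n.
  by move: (K) (p%:R^-1) => a b a0 b2; nra.
Qed.

End Density.

Unset Implicit Arguments.
Theorem theorem4p3 (R : realType) (k : nat -> fieldType)
  (hk : forall p : nat, prime p -> odd p -> perfect_char (k p) p)
  (n : nat) (hn : (3 <= n)%N) :
  (forall x : R, 0 <= x ->
     forall eps : R, 0 < eps -> exists P : nat, forall p : nat,
       prime p -> odd p -> (P <= p)%N ->
       `|hk_density (k p) p n x - finf n x| < eps)
  /\ (forall x : R, 0 <= x <= (n%:R - 2) / 2 -> finf n x = finf n (n%:R - x)).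
Proof.
have kp p : prime p -> odd p -> p \in [pchar (k p)] by move=> pp op; case: (hk p pp op).
split; last exact: finf_sym.
move=> x x0 eps eps0; have [C [P [C0 H]]] := O1_hq_finf hn kp x0.
pose B : R := (2 * (4 * n + 8))%:R + C.
exists (maxn P (Num.bound (B / eps))) => p pp op; rewrite geq_max => /andP[Pp Bp].
have pR : 0 < p%:R :> R by rewrite ltr0n prime_gt0.
have B0 : 0 <= B by rewrite addr_ge0.
have n0 : (0 < n)%N := ltnW (ltnW hn).
rewrite -(subrKA ((hq (k p) n p (fl x p))%:R / p%:R ^+ n)).
apply: (le_lt_trans (ler_normD _ _)).
apply: (le_lt_trans (lerD (hk_density_close (kp p pp op) op n0 x0) (H p pp op Pp))).
rewrite -mulrDl -/B ltr_pdivrMr // mulrC -ltr_pdivrMr //.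
apply: (lt_le_trans (archi_boundP _)); last by rewrite ler_nat.
by rewrite divr_ge0 // ltW.
Qed.
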